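(* Let $N\geq3$. If $1<p<\frac N2$, then $D_0^{2,p}(\mathbb Z^N)=D^{2,p}(\mathbb Z^N)$. If $1\le p<\frac N2$, then $\widetilde D_0^{2,p}(\mathbb Z^N)=\widetilde D^{2,p}(\mathbb Z^N)$.
   Context: $\mathbb Z^N$ is the integer lattice graph: $x\sim y$ iff $\sum_{i=1}^N|x_i-y_i|=1$, i.e. the Cayley graph with generating set $S=\{s_1,\dots,s_m\}$, $m=2N$, consisting of the vectors $\pm e_k$ ($e_k$ the standard basis). For $u:\mathbb Z^N\to\mathbb R$: $\Delta u(x):=\sum_{y\sim x}(u(y)-u(x))$, $\partial_iu(x):=u(x+s_i)-u(x)$, $\lVert u\rVert_{D^{2,p}}:=\lVert\Delta u\rVert_{\ell^p(\mathbb Z^N)}$, $\lVert u\rVert_{\widetilde D^{2,p}}:=\left(\sum_{i,j=1}^m\sum_{x}|\partial_j\partial_iu(x)|^p\right)^{1/p}$. $D_0^{2,p}(\mathbb Z^N)$ and $\widetilde D_0^{2,p}(\mathbb Z^N)$ are the completions of the finitely supported functions in these respective norms, elements being regarded as functions on $\mathbb Z^N$ (a Cauchy sequence of finitely supported functions is identified with its pointwise limit). $D^{2,p}(\mathbb Z^N):=\{u\in\ell^{\frac{Np}{N-2p}}(\mathbb Z^N):\lVert u\rVert_{D^{2,p}}<\infty\}$ and $\widetilde D^{2,p}(\mathbb Z^N):=\{u\in\ell^{\frac{Np}{N-2p}}(\mathbb Z^N):\lVert u\rVert_{\widetilde D^{2,p}}<\infty\}$. *)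

(* Defs.v *)
From mathcomp Require Import all_boot all_order all_algebra.
From mathcomp Require Import all_classical all_reals all_analysis.

Set Implicit Arguments.
Unset Strict Implicit.
Unset Printing Implicit Defensive.

Import Order.TTheory GRing.Theory Num.Theory.
Import numFieldNormedType.Exports.

Local Open Scope classical_set_scope.
Local Open Scope ring_scope.

Section Lattice.
Context {R : realType} {N : nat}.
Local Notation ZN := 'rV[int]_N.
Implicit Types (u : ZN -> R) (p : R).

Definition adj (x y : ZN) : Prop := \sum_(i < N) `|x 0 i - y 0 i| = 1.

(* The generators s_1, ..., s_{2N} are indexed by pairs (k, b): e_k for
   b = true and - e_k for b = false. *)
Definition gen (s : 'I_N * bool) : ZN :=
  if s.2 then delta_mx 0 s.1 else - delta_mx 0 s.1.

(* A finitely supported sum (\sum_(_ \in _)); the neighbour sets are finite,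
   see [laplacianE]. *)
Definition laplacian u (x : ZN) : R :=
  \sum_(y \in [set y | adj x y]) (u y - u x).

Definition pderiv (s : 'I_N * bool) u (x : ZN) : R := u (x + gen s) - u x.

(* Used for finite exponents p >= 1 only, where an infinite sum gives +oo. *)
Definition lnorm p u : \bar R :=
  ((\esum_(x in [set: ZN]) (`|u x| `^ p)%:E) `^ p^-1)%E.

Definition D2norm p u : \bar R := lnorm p (laplacian u).

Definition D2tnorm p u : \bar R :=
  ((\sum_(i : 'I_N * bool) \sum_(j : 'I_N * bool)
      \esum_(x in [set: ZN]) (`|pderiv j (pderiv i u) x| `^ p)%:E) `^ p^-1)%E.

Definition finitely_supported u : Prop := finite_set [set x | u x != 0].

(* The completion of the finitely supported functions for [nrm], each class of
   Cauchy sequences being identified with its pointwise limit. *)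
Definition completion (nrm : (ZN -> R) -> \bar R) : set (ZN -> R) :=
  [set u | exists phi : nat -> ZN -> R,
    [/\ forall n, finitely_supported (phi n),
        forall e : R, 0 < e -> exists n0 : nat, forall m n : nat,
          (n0 <= m)%N -> (n0 <= n)%N ->
          (nrm (phi m \- phi n)%R < e%:E)%E
      & forall x, phi n x @[n --> \oo] --> u x]].

Definition sobolev_exp p : R := N%:R * p / (N%:R - 2 * p).

Definition D2_0 p : set (ZN -> R) := completion (D2norm p).
Definition D2t_0 p : set (ZN -> R) := completion (D2tnorm p).

Definition D2 p : set (ZN -> R) :=
  [set u | (lnorm (sobolev_exp p) u < +oo)%E /\ (D2norm p u < +oo)%E].
Definition D2t p : set (ZN -> R) :=
  [set u | (lnorm (sobolev_exp p) u < +oo)%E /\ (D2tnorm p u < +oo)%E].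

Lemma genE s (i : 'I_N) : gen s 0 i = (-1) ^+ (~~ s.2) * (s.1 == i)%:R.
Proof.
case: s => k [] /=; rewrite /gen /= !mxE eqxx /= eq_sym.
  by rewrite expr0 mul1r.
by rewrite expr1 mulN1r.
Qed.

Lemma gen_inj : injective gen.
Proof.
move=> [k b] [l c] /rowP e; have := e k; rewrite !genE /= eqxx mulr1.
by case: (eqVneq l k) => [->|_]; case: b {e} => //; case: c.
Qed.

Lemma adjE x : [set y | adj x y] = [set x + gen s | s in [set: 'I_N * bool]].
Proof.
apply/seteqP; split=> y /=; last first.
  move=> [[k b] _ <-]; rewrite /adj (bigD1 k) //= big1 => [|i ik].
    by rewrite mxE genE eqxx opprD addNKr normrN mulr1 normr_sign addr0.
  by rewrite mxE genE /= eq_sym (negPf ik) mulr0 addr0 subrr normr0.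
rewrite /adj => h.
have [k xk] : exists k, x 0 k - y 0 k != 0.
  apply: contrapT => /forallNP nk; move: h; rewrite big1 => // i _.
  by have /negP := nk i; rewrite negbK => /eqP ->; rewrite normr0.
have k1 : 1 <= `|x 0 k - y 0 k| by rewrite -gtz0_ge1 normr_gt0.
have ge0 : 0 <= \sum_(i < N | i != k) `|x 0 i - y 0 i| by apply: sumr_ge0.
move: h; rewrite (bigD1 k) //= => h.
have r0 : \sum_(i < N | i != k) `|x 0 i - y 0 i| = 0.
  by apply/eqP; rewrite eq_le ge0 andbT -(lerD2l `|x 0 k - y 0 k|) h addr0.
have /eqP hk : `|x 0 k - y 0 k| = 1 by rewrite -h r0 addr0.
exists (k, x 0 k - y 0 k == -1) => //; apply/rowP => i.
rewrite mxE genE /=; case: (eqVneq k i) => [<-|ki].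
  move: hk; rewrite eqr_norml ler01 andbT => /orP[] /eqP e; rewrite e mulr1.
    by rewrite -[y 0 k](subKr (x 0 k)) e.
  by rewrite eqxx expr0 -[y 0 k](subKr (x 0 k)) e opprK.
rewrite eq_sym in ki.
have /eqP := psumr_eq0P (fun i _ => normr_ge0 (x 0 i - y 0 i)) r0 ki.
by rewrite mulr0 addr0 normr_eq0 subr_eq0 => /eqP.
Qed.

Lemma laplacianE u x : laplacian u x = \sum_(s : 'I_N * bool) pderiv s u x.
Proof.
rewrite /laplacian adjE fsbig_image; last first.
  by move=> s t _ _ /addrI /gen_inj.
rewrite [RHS]fsbig_seq ?index_enum_uniq//; apply: eq_fsbigl.
by apply/seteqP; split=> s //= _; rewrite mem_index_enum.
Qed.

End Lattice.

(* Main.v *)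
Require Import Defs.
From mathcomp Require Import all_boot all_order all_algebra.
From mathcomp Require Import all_classical all_reals all_analysis.
From mathcomp Require Import ring lra zify.

(** Both equalities are instances of one argument.  For a seminorm given by
    finitely many difference operators measured in l^p, a limit of a Cauchy
    sequence belongs to the second space as soon as a Sobolev inequality holds,
    by Fatou's lemma; conversely a function of the second space is a limit of
    finitely supported functions as soon as these are dense for the seminorm,
    and the Sobolev inequality, valid for all functions that tend to zero at
    infinity, turns convergence in the seminorm into pointwise convergence
    ([completion_energy_norm]).  So a Sobolev inequality and a density statement
    are needed for each of the two seminorms.

    All Sobolev inequalities come from the isoperimetric inequality of the
    lattice.  A finite set is translated by the points of a box with twice as
    many points, which bounds its cardinal by its perimeter
    ([box_isoperimetry]); peeling off level sets gives the l^1 Sobolev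
    inequality ([sobolev_l1]), and its application to powers [|u| ^ g] gives
    the first order inequality from l^p to l^(n p / (n - p)) ([sobolev1]).
    Truncation at small heights extends it from finitely supported functions to
    functions tending to zero.  Two applications give the inequality for all
    second differences, the case [p = 1] included ([sobolev2]).  For the
    Laplacian and [p > 1], testing [Delta u] with a signed power of [u] and the
    Stroock-Varopoulos inequality reduce the claim to the first order inequality
    in l^2 ([sobolev_laplacian]).

    Density for the Laplacian: it suffices to approximate a finitely supported
    [f] in l^p by Laplacians of finitely supported functions.  If [P] is the
    transition operator of the simple random walk, then [f] minus the mean of
    [f, P f, .., P^(m-1) f] is such a Laplacian, and this mean tends to zero in
    l^p, again by the Sobolev inequality ([laplacian_dense_finsupp]).

    Density for the second differences: [u] is multiplied by a cutoff at scale
    [m] whose first and second differences are of order [1/m] and [1/m^2].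
    Since the first differences of [u] lie in l^(n p / (n - p)), by the first
    order inequality, and [u] itself in l^(n p / (n - 2 p)), Hoelder's
    inequality controls all terms of the Leibniz rule
    ([cutoff_approximation]). *)

Set Implicit Arguments.
Unset Strict Implicit.
Unset Printing Implicit Defensive.

Import Order.TTheory GRing.Theory Num.Theory.
Import numFieldNormedType.Exports.

Local Open Scope classical_set_scope.
Local Open Scope ring_scope.

(** * Inequalities between powers *)

Section Powers.
Context {R : realType}.
Implicit Types a b c r s t x y : R.

Lemma powR_le x y r : 0 <= r -> 0 <= x -> x <= y -> x `^ r <= y `^ r.
Proof.
by move=> r0 x0 xy; apply: ge0_ler_powR; rewrite ?nnegrE// (le_trans x0).
Qed.

Lemma powRK x r : 0 <= x -> r != 0 -> (x `^ r) `^ r^-1 = x.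
Proof. by move=> x0 r0; rewrite -powRrM divff// powRr1. Qed.

Lemma powRVK x r : 0 <= x -> r != 0 -> (x `^ r^-1) `^ r = x.
Proof. by move=> x0 r0; rewrite -powRrM mulVf// powRr1. Qed.

Lemma powRD_ge0 x a b : 0 <= a -> 0 <= b -> x `^ (a + b) = x `^ a * x `^ b.
Proof.
move=> a0 b0; case: (eqVneq x 0) => [->|x0]; last first.
  by rewrite powRD// x0 implybT.
case: (eqVneq a 0) => [->|an0]; first by rewrite add0r powRr0 mul1r.
have ab0 : 0 < a + b by rewrite ltr_pwDl// lt_neqAle eq_sym an0.
by rewrite (powR0 an0) mul0r powR0 ?gt_eqF.
Qed.

(** This closes the estimates below in which the quantity to be bounded
    reappears on the right-hand side to a smaller power. *)
Lemma powR_absorb x c a b :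
  0 <= x -> 0 <= c -> b < a -> x `^ a <= c * x `^ b -> x <= c `^ (a - b)^-1.
Proof.
move=> x0 c0 ba; have ab0 : 0 < a - b by rewrite subr_gt0.
have [->|xn0] := eqVneq x 0; first by rewrite powR_ge0.
have xb : 0 < x `^ b by rewrite powR_gt0// lt_neqAle eq_sym xn0.
rewrite -ler_pdivrMr// -powRB ?xn0 ?implybT// => h.
rewrite -[x in x <= _](@powRK _ (a - b)) ?gt_eqF//.
by apply: powR_le; rewrite ?invr_ge0 ?powR_ge0// ltW.
Qed.

(** Bernoulli's inequality is Young's inequality for the product [y * 1]. *)
Lemma powR_bernoulli y c : 0 <= y -> 1 <= c -> 1 - y `^ c <= c * (1 - y).
Proof.
move=> y0; rewrite le_eqVlt => /predU1P[<-|c1]; first by rewrite powRr1// mul1r.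
have c0 : 0 < c by apply: lt_trans c1.
have d0 : 0 < 1 - c^-1 by rewrite subr_gt0 invf_lt1.
have := @conjugate_powR _ y 1 c (1 - c^-1)^-1 y0 ler01 c0.
rewrite invr_gt0 invrK powR1 mulr1 mul1r subrKC.
move=> /(_ d0 erefl).
rewrite -(ler_pM2l c0) mulrDr mulrBr mulr1 mulrCA !divff ?gt_eqF//.
rewrite mulr1 mulrBr mulr1; lra.
Qed.

(** In terms of [y = t `^ b] this compares [y `^ (a / b)] with [y]: Bernoulli's
    inequality if [a >= b], monotonicity in the exponent otherwise. *)
Lemma subr1_powR_le t a b : 0 <= t <= 1 -> 0 < a -> 0 < b ->
  1 - t `^ a <= Num.max 1 (a / b) * (1 - t `^ b).
Proof.
move=> /andP[t0 t1] a0 b0; set y := t `^ b.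
have y0 : 0 <= y by apply: powR_ge0.
have y1 : y <= 1.
  by have := powR_le (ltW b0) t0 t1; rewrite powR1.
have -> : t `^ a = y `^ (a / b).
  by rewrite /y -powRrM mulrCA divff ?mulr1// gt_eqF.
have [ab|ab] := leP 1 (a / b); first exact: powR_bernoulli.
rewrite mul1r lerD2l lerNl opprK.
have [->|yn0] := eqVneq y 0; first by rewrite powR_ge0.
by apply: ger1_powR; rewrite ?(ltW ab)// y1 andbT lt_neqAle eq_sym yn0.
Qed.

Lemma powR_lipschitz_le a b r : 1 <= r -> 0 <= b <= a ->
  a `^ r - b `^ r <= r * a `^ (r - 1) * (a - b).
Proof.
move=> r1 /andP[b0]; rewrite le_eqVlt => /predU1P[<-|ba].
  by rewrite !subrr mulr0.
have a0 : 0 < a by apply: le_lt_trans ba.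
have /powR_bernoulli := divr_ge0 b0 (ltW a0).
move=> /(_ _ r1); rewrite -(ler_pM2l (powR_gt0 r a0)) mulrBr mulr1.
rewrite -powRM ?(ltW a0)//; last by rewrite divr_ge0// ltW.
rewrite mulrCA divff ?gt_eqF// mulr1 => /le_trans; apply.
have -> : a `^ r = a `^ (r - 1) * a.
  by rewrite mulrC mulr_powRB1 ?(ltW a0)//; lra.
rewrite le_eqVlt; apply/orP; left; apply/eqP; field.
by rewrite gt_eqF.
Qed.

Lemma powR_lipschitz x y r : 1 <= r ->
  `| `|x| `^ r - `|y| `^ r| <=
  r * (`|x| `^ (r - 1) + `|y| `^ (r - 1)) * `|x - y|.
Proof.
move=> r1; have r0 : 0 <= r by lra.
wlog yx : x y / `|y| <= `|x|.
  move=> h; have [|/ltW] := leP `|y| `|x|; first exact: h.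
  move=> /h; rewrite distrC (distrC y x).
  by rewrite [`|y| `^ (r - 1) + _]addrC.
rewrite ger0_norm; last by rewrite subr_ge0 powR_le.
have := powR_lipschitz_le r1 (_ : 0 <= `|y| <= `|x|).
rewrite normr_ge0 => /(_ yx)/le_trans; apply.
rewrite -!mulrA ler_wpM2l// mulrDl -[leLHS]addr0 lerD//.
  by rewrite ler_wpM2l ?powR_ge0// lerB_dist.
Qed.

(** The signed power. *)
Definition spow r x : R := Num.sg x * `|x| `^ r.

Lemma spow0 r : spow r 0 = 0.
Proof. by rewrite /spow sgr0 mul0r. Qed.

Lemma spowN r x : spow r (- x) = - spow r x.
Proof. by rewrite /spow sgrN normrN mulNr. Qed.

Lemma spow_ge0 r x : 0 <= x -> 0 < r -> spow r x = x `^ r.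
Proof.
rewrite le_eqVlt => /predU1P[<-|x0] r0; first by rewrite spow0 powR0// gt_eqF.
by rewrite /spow gtr0_sg// mul1r gtr0_norm.
Qed.

Lemma norm_spow r x : 0 < r -> `|spow r x| = `|x| `^ r.
Proof.
move=> r0; have [->|xn0] := eqVneq x 0.
  by rewrite spow0 normr0 powR0// gt_eqF.
by rewrite /spow normrM normr_sg xn0 mul1r ger0_norm// powR_ge0.
Qed.

Lemma spow_le r x y : 0 < r -> x <= y -> spow r x <= spow r y.
Proof.
move=> r0 xy; have [x0|x0] := leP 0 x.
  by rewrite !spow_ge0 ?(le_trans x0)// powR_le// ltW.
have [y0|y0] := leP 0 y.
  apply: (@le_trans _ _ 0); last by rewrite spow_ge0// powR_ge0.
  by rewrite -oppr_ge0 -spowN spow_ge0 ?powR_ge0//; lra.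
rewrite -[x]opprK -[y]opprK !(spowN r (- _)) lerN2 !spow_ge0//; try lra.
by apply: powR_le; lra.
Qed.

Lemma stroock_varopoulos_ge0 r x y : 1 < r -> 0 <= y <= x ->
  (x `^ (r / 2) - y `^ (r / 2)) ^+ 2 <=
  Num.max 1 (r / 2) * Num.max 1 (r / 2 / (r - 1)) *
    ((x - y) * (x `^ (r - 1) - y `^ (r - 1))).
Proof.
move=> r1 /andP[y0]; rewrite le_eqVlt => /predU1P[<-|yx].
  by rewrite !subrr mul0r mulr0 expr0n.
have x0 : 0 < x by apply: le_lt_trans yx.
have r20 : 0 < r / 2 by lra.
have r10 : 0 < r - 1 by lra.
pose t := y / x; have t0 : 0 <= t by rewrite divr_ge0// ltW.
have t01 : 0 <= t <= 1 by rewrite t0 /= ler_pdivrMr// mul1r ltW.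
have yE : y = x * t by rewrite mulrC divfK// gt_eqF.
have h1 := subr1_powR_le t01 r20 ltr01; rewrite divr1 powRr1// in h1.
have h2 := subr1_powR_le t01 r20 r10.
have h0 : 0 <= 1 - t `^ (r / 2).
  case/andP: (t01) => _ /(powR_le (ltW r20) t0).
  by rewrite powR1 subr_ge0.
rewrite yE; move: t0 h0 h1 h2 => {yE t01}; move: t => t t0 h0 h1 h2.
rewrite !powRM ?(ltW x0)//.
have -> : x `^ (r / 2) - x `^ (r / 2) * t `^ (r / 2) =
  x `^ (r / 2) * (1 - t `^ (r / 2)) by ring.
rewrite exprMn -powR_mulrn ?powR_ge0// -powRrM divfK ?pnatr_eq0//.
have -> : x `^ r = x * x `^ (r - 1).
  by rewrite mulr_powRB1 ?(ltW x0)//; lra.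
have xr : 0 <= x * x `^ (r - 1) by rewrite mulr_ge0 ?powR_ge0// ltW.
have := ler_wpM2l xr (ler_pM h0 h0 h1 h2).
by rewrite -expr2 => /le_trans; apply; rewrite le_eqVlt; apply/orP; left;
  apply/eqP; ring.
Qed.

(** On the half line both differences of powers are compared with a difference
    of first powers after scaling the larger argument to [1]; for arguments of
    opposite signs the right-hand side already dominates [|x|^r + |y|^r]. *)
Lemma stroock_varopoulos r : 1 < r -> exists2 K : R, 0 < K &
  forall x y, (`|x| `^ (r / 2) - `|y| `^ (r / 2)) ^+ 2 <=
    K * ((x - y) * (spow (r - 1) x - spow (r - 1) y)).
Proof.
move=> r1; pose K := Num.max 1 (r / 2) * Num.max 1 (r / 2 / (r - 1)).
have K1 : 1 <= K.
  by rewrite -[1]mulr1 ler_pM// ?le_max ?lexx.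
have r10 : 0 < r - 1 by lra.
exists K; first lra.
move=> x y; wlog yx : x y / `|y| <= `|x|.
  move=> h; have [|/ltW] := leP `|y| `|x|; first exact: h.
  move=> /h; rewrite -sqrrN opprB => /le_trans; apply.
  by rewrite le_eqVlt; apply/orP; left; apply/eqP; ring.
wlog x0 : x y yx / 0 <= x.
  move=> h; have [|x0] := leP 0 x; first exact: h.
  have := h (- x) (- y); rewrite !normrN !spowN => /(_ yx).
  have -> : 0 <= - x by lra.
  move=> /(_ isT)/le_trans; apply.
  by rewrite le_eqVlt; apply/orP; left; apply/eqP; ring.
rewrite (ger0_norm x0) in yx *.
have [y0|y0] := leP 0 y.
  rewrite ger0_norm// in yx *; rewrite !spow_ge0//.
  by apply: stroock_varopoulos_ge0; rewrite ?y0.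
set z := - y; have z0 : 0 <= z by rewrite /z; lra.
have yE : y = - z by rewrite /z opprK.
rewrite yE normrN spowN !opprK !spow_ge0// (ger0_norm z0).
have xr : x `^ r = x * x `^ (r - 1) by rewrite mulr_powRB1//; lra.
have zr : z `^ r = z * z `^ (r - 1) by rewrite mulr_powRB1//; lra.
have sq u : 0 <= u -> u `^ (r / 2) * u `^ (r / 2) = u `^ r.
  by move=> u0; rewrite -powRD_ge0 -?splitr//; lra.
apply: (@le_trans _ _ ((x + z) * (x `^ (r - 1) + z `^ (r - 1)))); last first.
  by rewrite -[leLHS]mul1r ler_wpM2r// mulr_ge0// addr_ge0 ?powR_ge0.
have := sq _ x0; have := sq _ z0.
have := mulr_ge0 (powR_ge0 x (r / 2)) (powR_ge0 z (r / 2)).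
have := mulr_ge0 x0 (powR_ge0 z (r - 1)).
have := mulr_ge0 z0 (powR_ge0 x (r - 1)).
rewrite xr zr; set A := x `^ (r / 2); set B := z `^ (r / 2).
set C := x `^ _; set D := z `^ _ => *; nra.
Qed.

Lemma powRDn_le x y r : 0 <= r -> 0 <= x -> 0 <= y ->
  (x + y) `^ r <= 2 `^ r * (x `^ r + y `^ r).
Proof.
move=> r0; wlog yx : x y / y <= x.
  move=> h x0 y0; have [/h->//|/ltW yx] := leP y x.
  by rewrite addrC [x `^ r + _]addrC h.
move=> x0 y0; apply: (@le_trans _ _ ((2 * x) `^ r)).
  by apply: powR_le => //; lra.
by rewrite powRM// ler_wpM2l ?powR_ge0// lerDl powR_ge0.
Qed.

Lemma powR_normD_le x y r : 0 <= r ->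
  `|x + y| `^ r <= 2 `^ r * (`|x| `^ r + `|y| `^ r).
Proof.
move=> r0; apply: le_trans (powRDn_le r0 (normr_ge0 x) (normr_ge0 y)).
by apply: powR_le => //; exact: ler_normD.
Qed.

End Powers.

Section FiniteSums.
Context {R : realType} {T : eqType}.
Implicit Types (s : seq T) (f g : T -> R).

Lemma sum_powR_le0 s f (r : R) x : (forall x, 0 <= f x) ->
  \sum_(x <- s) f x `^ r <= 0 -> x \in s -> f x = 0.
Proof.
move=> f0 fs xs; have s0 : \sum_(x <- s) f x `^ r = 0.
  by apply/eqP; rewrite eq_le fs/= sumr_ge0// => *; exact: powR_ge0.
suff /powR_eq0_eq0 -> : f x `^ r = 0 by [].
apply/eqP; move: s0 => /eqP; rewrite psumr_eq0 => [/allP/(_ _ xs)//|*].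
exact: powR_ge0.
Qed.

(** Young's inequality, applied termwise to [f / F^(1/p)] and [g / G^(1/q)]. *)
Lemma hoelder_seq s f g (p q F G : R) :
  0 < p -> 0 < q -> p^-1 + q^-1 = 1 ->
  (forall x, 0 <= f x) -> (forall x, 0 <= g x) ->
  \sum_(x <- s) f x `^ p <= F -> \sum_(x <- s) g x `^ q <= G ->
  \sum_(x <- s) f x * g x <= F `^ p^-1 * G `^ q^-1.
Proof.
move=> p0 q0 pq f0 g0.
move=> fF gG; have rhs0 : 0 <= F `^ p^-1 * G `^ q^-1.
  by rewrite mulr_ge0 ?powR_ge0.
have [F0|F0] := boolP (0 < F); last first.
  rewrite -leNgt in F0; rewrite big1_seq// => x /andP[_ xs].
  by rewrite (sum_powR_le0 f0 (le_trans fF F0) xs) mul0r.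
have [G0|G0] := boolP (0 < G); last first.
  rewrite -leNgt in G0; rewrite big1_seq// => x /andP[_ xs].
  by rewrite (sum_powR_le0 g0 (le_trans gG G0) xs) mulr0.
set a := F `^ p^-1; set b := G `^ q^-1.
have a0 : 0 < a by rewrite powR_gt0.
have b0 : 0 < b by rewrite powR_gt0.
have ap : a `^ p = F by rewrite powRVK ?(ltW F0)// gt_eqF.
have bq : b `^ q = G by rewrite powRVK ?(ltW G0)// gt_eqF.
rewrite -[leRHS]mulr1 -ler_pdivrMl ?mulr_gt0// mulr_sumr.
apply: (@le_trans _ _ (\sum_(x <- s) (f x `^ p / F / p + g x `^ q / G / q))).
  apply: ler_sum => x _.
  have -> : (a * b)^-1 * (f x * g x) = (f x / a) * (g x / b).
    by field; rewrite !gt_eqF.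
  have := @conjugate_powR _ (f x / a) (g x / b) p q.
  rewrite !divr_ge0 ?(ltW a0) ?(ltW b0)// => /(_ isT isT p0 q0 pq)/le_trans.
  apply; rewrite !powRM ?invr_ge0 ?(ltW a0) ?(ltW b0)//.
  by rewrite -!(powR_inv1 (ltW a0)) -!(powR_inv1 (ltW b0)) !(powRAC _ (-1)) ap bq
    !powR_inv1 ?(ltW F0) ?(ltW G0).
rewrite big_split/= -!mulr_suml -pq lerD//.
  by rewrite -[leRHS]mul1r ler_wpM2r ?invr_ge0 ?(ltW p0)// ler_pdivrMr// mul1r.
by rewrite -[leRHS]mul1r ler_wpM2r ?invr_ge0 ?(ltW q0)// ler_pdivrMr// mul1r.
Qed.

(** The convexity of [x `^ r] applied to the convex combination
    [(f + g) / (F + G)] of [f / F] and [g / G]. *)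
Lemma minkowski_seq s f g (r F G : R) : 1 <= r -> 0 <= F -> 0 <= G ->
  (forall x, 0 <= f x) -> (forall x, 0 <= g x) ->
  \sum_(x <- s) f x `^ r <= F `^ r -> \sum_(x <- s) g x `^ r <= G `^ r ->
  \sum_(x <- s) (f x + g x) `^ r <= (F + G) `^ r.
Proof.
move=> r1 + + f0 g0; have r0 : 0 < r by lra.
rewrite le_eqVlt => /predU1P[<- _|F0].
  rewrite powR0 ?gt_eqF// => /(@sum_powR_le0 _ _ _ _ f0) fz.
  rewrite add0r => /(le_trans _); apply; rewrite le_eqVlt; apply/orP; left.
  by apply/eqP; apply: eq_big_seq => x /fz ->; rewrite add0r.
rewrite le_eqVlt => /predU1P[<- +|G0].
  rewrite [0 `^ r]powR0 ?gt_eqF// => + /(@sum_powR_le0 _ _ _ _ g0) gz.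
  rewrite addr0 => /(le_trans _); apply; rewrite le_eqVlt; apply/orP; left.
  by apply/eqP; apply: eq_big_seq => x /gz ->; rewrite addr0.
move=> fF gG; have S0 : 0 < F + G by rewrite addr_gt0.
pose t := F / (F + G).
have t0 : 0 <= t by rewrite divr_ge0// ltW.
have t1 : t <= 1 by rewrite ler_pdivrMr// mul1r lerDl ltW.
have t1E : 1 - t = G / (F + G).
  by rewrite /t; field; rewrite gt_eqF.
have t'0 : 0 <= 1 - t by rewrite subr_ge0.
have key x : (f x + g x) `^ r <= (F + G) `^ r *
   (t / F `^ r * f x `^ r + (1 - t) / G `^ r * g x `^ r).
  have /= := @convex_powR _ r r1 (Itv01 t0 t1) (f x / F) (g x / G).
  rewrite !inE /= !in_itv /= !divr_ge0 ?(ltW F0) ?(ltW G0)// => /(_ isT isT).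
  move=> h; rewrite convRE [X in X `^ _ <= _]convRE /= /unstable.onem in h.
  have -> : f x + g x = (F + G) * (t * (f x / F) + (1 - t) * (g x / G)).
    by rewrite t1E /t; field; rewrite !gt_eqF.
  rewrite powRM ?(ltW S0)//; last first.
    by rewrite addr_ge0// mulr_ge0// divr_ge0// ltW.
  rewrite ler_wpM2l ?powR_ge0//; apply: le_trans h _.
  rewrite !powRM ?invr_ge0 ?(ltW F0) ?(ltW G0)//.
  rewrite -!(powR_inv1 (ltW F0)) -!(powR_inv1 (ltW G0)) !(powRAC _ (-1)).
  rewrite !powR_inv1 ?powR_ge0// le_eqVlt; apply/orP; left; apply/eqP; ring.
apply: (@le_trans _ _ (\sum_(x <- s) ((F + G) `^ r *
   (t / F `^ r * f x `^ r + (1 - t) / G `^ r * g x `^ r)))).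
  by apply: ler_sum.
rewrite -mulr_sumr -[leRHS]mulr1 ler_wpM2l ?powR_ge0//.
rewrite big_split/= -!mulr_sumr -[leRHS](subrKC t) lerD//.
  rewrite -mulrA -[leRHS]mulr1 ler_wpM2l// ler_pdivrMl ?mulr1//.
  by rewrite powR_gt0.
rewrite -mulrA -[leRHS]mulr1 ler_wpM2l ?subr_ge0// ler_pdivrMl ?mulr1//.
by rewrite powR_gt0.
Qed.

End FiniteSums.

(** * Sums of functions on the lattice *)

Section LatticeSums.
Context {R : realType} {N : nat}.
Local Notation ZN := 'rV[int]_N.
Implicit Types (u v f g h : ZN -> R) (s t : seq ZN) (B C p q r : R).

(** For nonnegative [f] this says that the possibly infinite sum of [f] is at
    most [B]; it keeps all estimates inside the real numbers. *)
Definition sums_le f B := forall s, uniq s -> \sum_(x <- s) f x <= B.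

Definition fsum f : R := \sum_(x \in [set: ZN]) f x.

Lemma finsuppP f : finitely_supported f <->
  exists2 s, uniq s & forall x, x \notin s -> f x = 0.
Proof.
split=> [/finite_seqP[s fs]|[s us f0]].
  exists (undup s) => [|x]; first exact: undup_uniq.
  rewrite mem_undup => /negP xs; apply: contrapT => /eqP fx; apply: xs.
  by have : [set x | f x != 0] x by []; rewrite fs.
apply: (sub_finite_set _ (finite_seq s)) => x /= fx.
by apply: contraNT fx => /f0 ->.
Qed.

Lemma finsupp_sub f g : finitely_supported f ->
  (forall x, f x = 0 -> g x = 0) -> finitely_supported g.
Proof.
by move=> /finsuppP[s us f0] fg; apply/finsuppP; exists s => // x /f0/fg.
Qed.

Lemma finsupp_sub2 f g h : finitely_supported f -> finitely_supported g ->
  (forall x, f x = 0 -> g x = 0 -> h x = 0) -> finitely_supported h.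
Proof.
move=> /finsuppP[s us f0] /finsuppP[t ut g0] fgh; apply/finsuppP.
exists (undup (s ++ t)); first exact: undup_uniq.
move=> x; rewrite mem_undup mem_cat negb_or => /andP[/f0 fx /g0 gx].
exact: fgh.
Qed.

Lemma finsupp0 : finitely_supported (fun _ : ZN => 0 : R).
Proof. by apply/finsuppP; exists [::]. Qed.

Lemma finsupp_sum (J : Type) (r : seq J) (P : pred J) (F : J -> ZN -> R) :
  (forall j, finitely_supported (F j)) ->
  finitely_supported (fun x => \sum_(j <- r | P j) F j x).
Proof.
move=> Ffs; elim: r => [|j r IH].
  by apply: (finsupp_sub finsupp0) => x _; rewrite big_nil.
apply: (finsupp_sub2 (Ffs j) IH) => x Fj Fr; rewrite big_cons Fj Fr addr0.
by case: ifP.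
Qed.

Lemma finsupp_shift f (y : ZN) : finitely_supported f ->
  finitely_supported (fun x => f (x + y)).
Proof.
move=> /finsuppP[s us f0]; apply/finsuppP; exists [seq x - y | x <- s].
  by rewrite map_inj_uniq//; exact: addIr.
move=> x xs; apply: f0; apply: contra xs => xs.
by apply/mapP; exists (x + y) => //; rewrite addrK.
Qed.

Lemma fsumE s f : uniq s -> (forall x, x \notin s -> f x = 0) ->
  fsum f = \sum_(x <- s) f x.
Proof.
move=> us f0; rewrite /fsum (fsbigE s)//.
  by apply: eq_bigl => x; rewrite in_setT.
by move=> x _ /f0.
Qed.

Lemma eq_fsum f g : f =1 g -> fsum f = fsum g.
Proof. by move=> fg; congr fsum; exact/funext. Qed.

Lemma fsum_shift f (y : ZN) : fsum (fun x => f (x + y)) = fsum f.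
Proof.
apply/esym/(reindex_fsbigT (fun x : ZN => x + y)).
by exists (fun x => x - y) => x; rewrite ?addrK ?subrK.
Qed.

Lemma fsumD f g : finitely_supported f -> finitely_supported g ->
  fsum (fun x => f x + g x) = fsum f + fsum g.
Proof.
move=> /finsuppP[s us f0] /finsuppP[t ut g0].
pose w := undup (s ++ t); have uw : uniq w := undup_uniq _.
have h x : x \notin w -> f x = 0 /\ g x = 0.
  by rewrite mem_undup mem_cat negb_or => /andP[/f0 -> /g0 ->].
rewrite !(@fsumE w) ?big_split// => x /h[fx gx]; rewrite ?fx ?gx ?addr0//.
Qed.

Lemma fsumZ f (c : R) : fsum (fun x => c * f x) = c * fsum f.
Proof. by rewrite /fsum mulr_fsumr. Qed.

Lemma fsumN f : fsum (fun x => - f x) = - fsum f.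
Proof.
rewrite -mulN1r -fsumZ; apply: eq_fsum => x; by rewrite mulN1r.
Qed.

Lemma fsumB f g : finitely_supported f -> finitely_supported g ->
  fsum (fun x => f x - g x) = fsum f - fsum g.
Proof.
move=> ff gf; rewrite fsumD ?fsumN//.
by apply: (finsupp_sub gf) => x ->; rewrite oppr0.
Qed.

Lemma fsum_sum (J : Type) (r : seq J) (F : J -> ZN -> R) :
  (forall j, finitely_supported (F j)) ->
  fsum (fun x => \sum_(j <- r) F j x) = \sum_(j <- r) fsum (F j).
Proof.
move=> Ffs; elim: r => [|j r IH].
  rewrite big_nil (@fsumE [::])// ?big_nil// => x _; by rewrite big_nil.
rewrite big_cons -IH -fsumD//; last exact: finsupp_sum.
by apply: eq_fsum => x; rewrite big_cons.
Qed.

Lemma fsum_ge0 f : (forall x, 0 <= f x) -> 0 <= fsum f.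
Proof. by move=> f0; apply: fsumr_ge0. Qed.

Lemma fsum_le f g : finitely_supported f -> finitely_supported g ->
  (forall x, f x <= g x) -> fsum f <= fsum g.
Proof.
move=> ff gf fg; rewrite -subr_ge0 -fsumB//.
by apply: fsum_ge0 => x; rewrite subr_ge0.
Qed.

Lemma sums_le_fsum f : finitely_supported f -> (forall x, 0 <= f x) ->
  sums_le f (fsum f).
Proof.
move=> /finsuppP[s us f0] fge0 t ut.
rewrite (@fsumE (undup (t ++ s))) ?undup_uniq//; last first.
  by move=> x; rewrite mem_undup mem_cat negb_or => /andP[_ /f0].
rewrite [leRHS](bigID (mem t))/= -[leLHS]addr0 lerD ?sumr_ge0//.
rewrite -[leRHS]big_filter [leRHS](perm_big t)//.
apply: uniq_perm => //; first by rewrite filter_uniq// undup_uniq.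
move=> x; rewrite mem_filter mem_undup mem_cat.
by case: (x \in t).
Qed.

Lemma fsum_le_sums f B : finitely_supported f -> sums_le f B -> fsum f <= B.
Proof.
by move=> /finsuppP[s us f0] fB; rewrite (fsumE us f0); exact: fB.
Qed.

Lemma sums_le_ge0 f B : sums_le f B -> 0 <= B.
Proof. by move=> /(_ [::] isT); rewrite big_nil. Qed.

Lemma sums_le_mono f g B C : sums_le g B -> (forall x, f x <= g x) -> B <= C ->
  sums_le f C.
Proof.
move=> gB fg BC s us; apply: le_trans BC; apply: le_trans (gB s us).
exact: ler_sum.
Qed.

Lemma sums_leD f g B C : sums_le f B -> sums_le g C ->
  sums_le (fun x => f x + g x) (B + C).
Proof. by move=> fB gC s us; rewrite big_split lerD ?fB ?gC. Qed.

Lemma sums_leZ f B c : 0 <= c -> sums_le f B ->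
  sums_le (fun x => c * f x) (c * B).
Proof. by move=> c0 fB s us; rewrite -mulr_sumr ler_wpM2l// fB. Qed.

Lemma sums_le_shift f B (y : ZN) : sums_le f B ->
  sums_le (fun x => f (x + y)) B.
Proof.
move=> fB s us; rewrite -(big_map (fun x => x + y) xpredT f); apply: fB.
by rewrite map_inj_uniq//; exact: addIr.
Qed.

Lemma sums_le_point f B x : sums_le f B -> f x <= B.
Proof. by move=> /(_ [:: x] isT); rewrite big_seq1. Qed.

Lemma cvg_sum_seq (J : Type) (r : seq J) (F : nat -> J -> R) (l : J -> R) :
  (forall j, F n j @[n --> \oo] --> l j) ->
  \sum_(j <- r) F n j @[n --> \oo] --> \sum_(j <- r) l j.
Proof.
move=> Fl; elim: r => [|j r IH].
  by rewrite big_nil; under eq_fun do rewrite big_nil; exact: cvg_cst.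
by rewrite big_cons; under eq_fun do rewrite big_cons; exact: cvgD.
Qed.

(** Fatou's lemma. *)
Lemma sums_le_lim (F : nat -> ZN -> R) f B :
  (forall x, F n x @[n --> \oo] --> f x) ->
  (forall n, sums_le (F n) B) -> sums_le f B.
Proof.
move=> Ff FB s us.
have sF : \sum_(x <- s) F n x @[n --> \oo] --> \sum_(x <- s) f x.
  exact: cvg_sum_seq.
rewrite -(cvg_lim _ sF)//; apply: limr_le; first by apply/cvg_ex; eexists; exact: sF.
by apply: nearW => n; exact: FB.
Qed.

Lemma sums_leP f B : (forall x, 0 <= f x) ->
  sums_le f B <-> (\esum_(x in [set: ZN]) (f x)%:E <= B%:E)%E.
Proof.
move=> f0; split=> [fB|fB s us].
  apply: ge_ereal_sup => _ [A [fA _] <-].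
  rewrite fsbig_finite//= sumEFin lee_fin; apply: fB.
  exact: finmap.fset_uniq.
rewrite -lee_fin; apply: le_trans fB; apply: ereal_sup_ubound.
exists [set` s]; first by split => //; exact: finite_seq.
by rewrite -fsbig_seq// sumEFin.
Qed.

Lemma esum_ltyP f : (forall x, 0 <= f x) ->
  (\esum_(x in [set: ZN]) (f x)%:E < +oo)%E <-> exists B, sums_le f B.
Proof.
move=> f0; have e0 : (0 <= \esum_(x in [set: ZN]) (f x)%:E)%E.
  by apply: esum_ge0 => x _; rewrite lee_fin.
split=> [fy|[B /sums_leP fB]].
  exists (fine (\esum_(x in [set: ZN]) (f x)%:E)); apply/sums_leP => //.
  by rewrite fineK// ge0_fin_numE.
by apply: le_lt_trans (fB _) (ltry _).
Qed.

(** The set [s] is one for which the finite sum comes within [e] of the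
    supremum of all finite sums. *)
Lemma sums_tail f B (e : R) : (forall x, 0 <= f x) -> sums_le f B -> 0 < e ->
  exists2 s, uniq s & sums_le (fun x => if x \in s then 0 else f x) e.
Proof.
move=> f0 fB e0.
pose S := [set \sum_(x <- s) f x | s in [set s : seq ZN | uniq s]].
have hS : has_sup S.
  split; first by exists 0, [::] => //; rewrite big_nil.
  by exists B => _ [s us <-]; exact: fB.
have [_ [s us <-] hs] := sup_adherent e0 hS.
exists s => // t ut; under eq_bigr do rewrite -if_neg.
rewrite -big_mkcond -big_filter.
set t' := [seq x <- t | _].
have : \sum_(x <- s ++ t') f x <= sup S.
  apply: sup_ubound; first by case: hS.
  exists (s ++ t') => //=; rewrite cat_uniq us filter_uniq// andbT/=.
  by apply/hasPn => x; rewrite mem_filter => /andP[].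
by rewrite big_cat/=; lra.
Qed.

Lemma sums_hoelder f g p q (F G : R) :
  0 < p -> 0 < q -> p^-1 + q^-1 = 1 ->
  (forall x, 0 <= f x) -> (forall x, 0 <= g x) ->
  sums_le (fun x => f x `^ p) F -> sums_le (fun x => g x `^ q) G ->
  sums_le (fun x => f x * g x) (F `^ p^-1 * G `^ q^-1).
Proof.
move=> p0 q0 pq f0 g0 fF gG s us.
by apply: hoelder_seq => //; [exact: fF|exact: gG].
Qed.

Lemma sums_le_powD f g p B C : 0 <= p ->
  sums_le (fun x => `|f x| `^ p) B -> sums_le (fun x => `|g x| `^ p) C ->
  sums_le (fun x => `|f x + g x| `^ p) (2 `^ p * (B + C)).
Proof.
move=> p0 fB gC.
apply: (sums_le_mono (sums_leZ (powR_ge0 2 p) (sums_leD fB gC))) => // x.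
exact: powR_normD_le.
Qed.

Definition vanishing u := forall e : R, 0 < e -> finite_set [set x | e <= `|u x|].

Lemma vanishing_finsupp u : finitely_supported u -> vanishing u.
Proof.
move=> fu e e0; apply: (sub_finite_set _ fu) => x /= eu.
by rewrite -normr_gt0 (lt_le_trans e0).
Qed.

Lemma vanishing_sums u q B : 0 < q ->
  sums_le (fun x => `|u x| `^ q) B -> vanishing u.
Proof.
move=> q0 uB e e0.
have [|s us hs] := sums_tail (fun x => powR_ge0 `|u x| q) uB (_ : 0 < (e / 2) `^ q).
  by rewrite powR_gt0; lra.
apply: (sub_finite_set _ (finite_seq s)) => x /= eu.
apply/negPn/negP => xs; have := sums_le_point x hs.
rewrite (negPf xs) leNgt => /negP; apply.
by apply: gt0_ltr_powR => //; rewrite ?nnegrE; lra.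
Qed.

Lemma vanishingB u v : vanishing u -> vanishing v ->
  vanishing (fun x => u x - v x).
Proof.
move=> uv vv e e0; have e20 : 0 < e / 2 by lra.
have fin : finite_set ([set x | e / 2 <= `|u x|] `|` [set x | e / 2 <= `|v x|]).
  by rewrite finite_setU; split; [exact: uv|exact: vv].
apply: sub_finite_set fin.
move=> x /= /le_trans/(_ (ler_normB _ _)) ex.
by have [?|?] := leP (e / 2) `|u x|; [left|right] => //; lra.
Qed.

Lemma vanishing_shift u (y : ZN) : vanishing u ->
  vanishing (fun x => u (x + y)).
Proof.
move=> uv e e0; have := finite_image (fun x => x - y) (uv e e0).
apply: sub_finite_set => x /= ex.
by exists (x + y) => //; rewrite addrK.
Qed.

End LatticeSums.

(** * The isoperimetric and the l^1 Sobolev inequality *)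

Section Isoperimetry.
Context {R : realType} {N : nat}.
Local Notation ZN := 'rV[int]_N.
Implicit Types (u f w : ZN -> R) (s : seq ZN).

Definition tv f : R := \sum_(i : 'I_N * bool) fsum (fun x => `|pderiv i f x|).

Lemma finsupp_pderiv i f : finitely_supported f ->
  finitely_supported (pderiv i f).
Proof.
move=> ff; apply: (finsupp_sub2 ff (finsupp_shift (gen i) ff)) => x fx fy.
by rewrite /pderiv fx fy subrr.
Qed.

Lemma finsupp_norm f : finitely_supported f ->
  finitely_supported (fun x => `|f x|).
Proof. by move=> ff; apply: (finsupp_sub ff) => x ->; rewrite normr0. Qed.

Lemma finsupp_normpow f (r : R) : r != 0 -> finitely_supported f ->
  finitely_supported (fun x => `|f x| `^ r).
Proof.
by move=> r0 ff; apply: (finsupp_sub ff) => x ->; rewrite normr0 powR0.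
Qed.

Lemma tv_ge0 f : 0 <= tv f.
Proof. by apply: sumr_ge0 => i _; apply: fsum_ge0 => x. Qed.

Definition transl_var f (y : ZN) : R := fsum (fun x => `|f (x + y) - f x|).

Lemma transl_varD f y z : finitely_supported f ->
  transl_var f (y + z) <= transl_var f y + transl_var f z.
Proof.
move=> ff; have fsd t : finitely_supported (fun x => `|f (x + t) - f x|).
  apply: (finsupp_sub2 ff (finsupp_shift t ff)) => x fx fy.
  by rewrite fx fy subrr normr0.
rewrite /transl_var -(fsum_shift (fun x => `|f (x + z) - f x|) y) -fsumD//.
  apply: fsum_le => // [|x].
    apply: (finsupp_sub2 (fsd y) (finsupp_shift y (fsd z))) => x -> ->.
    by rewrite addr0.
  by rewrite addrA [leRHS]addrC; apply: le_trans (ler_normD _ _); rewrite addrA subrK.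
exact: (finsupp_shift y (fsd z)).
Qed.

Lemma transl_var0 f : transl_var f 0 = 0.
Proof.
rewrite /transl_var (@fsumE _ _ [::]) ?big_nil// => x _.
by rewrite addr0 subrr normr0.
Qed.

Lemma transl_var_sum (J : Type) (r : seq J) (F : J -> ZN) f :
  finitely_supported f ->
  transl_var f (\sum_(j <- r) F j) <= \sum_(j <- r) transl_var f (F j).
Proof.
move=> ff; elim: r => [|j r IH]; first by rewrite !big_nil transl_var0.
by rewrite !big_cons; apply: le_trans (transl_varD _ _ ff) _; rewrite lerD2l.
Qed.

Lemma transl_varMn f y n : finitely_supported f ->
  transl_var f (y *+ n) <= transl_var f y *+ n.
Proof.
move=> ff; elim: n => [|n IH]; first by rewrite !mulr0n transl_var0.
by rewrite !mulrS; apply: le_trans (transl_varD _ _ ff) _; rewrite lerD2l.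
Qed.

Lemma transl_var_gen f i : finitely_supported f -> transl_var f (gen i) <= tv f.
Proof.
move=> ff; rewrite /tv (bigD1 i)//= lerDl.
by apply: sumr_ge0 => *; apply: fsum_ge0.
Qed.

Definition box_pt (r : nat) (g : {ffun 'I_N -> 'I_r}) : ZN :=
  \sum_k gen (k, true) *+ g k.

Lemma box_ptE r (g : {ffun 'I_N -> 'I_r}) k : box_pt g 0 k = (g k)%:Z.
Proof.
rewrite /box_pt summxE (bigD1 k)//= big1 => [|j jk].
  by rewrite mulmxnE genE /= eqxx mulr1 expr0 addr0 natz.
by rewrite mulmxnE genE /= (negPf jk) mulr0 mul0rn.
Qed.

Lemma box_pt_inj r : injective (@box_pt r).
Proof.
move=> g h gh; apply/ffunP => k; apply/val_inj.
by have := box_ptE g k; rewrite gh box_ptE => -[].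
Qed.

Lemma transl_var_box r (g : {ffun 'I_N -> 'I_r}) f : finitely_supported f ->
  transl_var f (box_pt g) <= N%:R * (r%:R * tv f).
Proof.
move=> ff; apply: le_trans (transl_var_sum _ _ ff) _.
apply: (@le_trans _ _ (\sum_(k < N) r%:R * tv f)); last first.
  by rewrite sumr_const card_ord -[leLHS]mulr_natl.
apply: ler_sum => k _; apply: le_trans (transl_varMn _ _ ff) _.
rewrite -[leLHS]mulr_natl ler_pM// ?ler_nat ?(ltnW (ltn_ord _))//.
  by apply: fsum_ge0.
exact: transl_var_gen.
Qed.

Definition indic_seq s (x : ZN) : R := (x \in s)%:R.

Lemma finsupp_indic s : finitely_supported (indic_seq s).
Proof.
apply/finsuppP; exists (undup s) => [|x]; first exact: undup_uniq.
by rewrite mem_undup /indic_seq => /negPf ->.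
Qed.

(** Moving a set [A] by the points [y] of a box with at least [2 |A|] points
    pushes at least half of [A] off itself on average, while a single move
    changes the indicator function by at most [|y|] times its total variation. *)
Lemma box_isoperimetry s r : uniq s -> (2 * size s <= r ^ N)%N ->
  (size s)%:R <= 2 * N%:R * r%:R * tv (indic_seq s).
Proof.
move=> us hr; set f := indic_seq s; set n := size s.
have ff : finitely_supported f := finsupp_indic s.
have [/eqP n0|n0] := boolP (n == 0%N).
  by rewrite n0 !mulr_ge0// tv_ge0.
have up : \sum_(g : {ffun 'I_N -> 'I_r}) transl_var f (box_pt g) <=
    (r ^ N)%:R * (N%:R * (r%:R * tv f)).
  apply: (@le_trans _ _ (\sum_(g : {ffun 'I_N -> 'I_r}) N%:R * (r%:R * tv f))).
    by apply: ler_sum => g _; exact: transl_var_box.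
  by rewrite sumr_const card_ffun !card_ord -[leLHS]mulr_natl.
have lo : n%:R * ((r ^ N)%:R - n%:R) <=
    \sum_(g : {ffun 'I_N -> 'I_r}) transl_var f (box_pt g).
  apply: (@le_trans _ _ (\sum_(g : {ffun 'I_N -> 'I_r})
      \sum_(x <- s) (1 - f (x + box_pt g)))); last first.
    apply: ler_sum => g _.
    have fs' : finitely_supported (fun x => `|f (x + box_pt g) - f x|).
      apply: (finsupp_sub2 ff (finsupp_shift (box_pt g) ff)) => x fx fy.
      by rewrite fx fy subrr normr0.
    apply: le_trans (sums_le_fsum fs' _ us) => //.
    rewrite big_seq [leRHS]big_seq; apply: ler_sum => x xs.
    have -> : f x = 1 by rewrite /f /indic_seq xs.
    by rewrite distrC; exact: ler_norm.
  rewrite exchange_big/=.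
  have -> : n%:R * ((r ^ N)%:R - n%:R) = \sum_(x <- s) ((r ^ N)%:R - n%:R) :> R.
    by rewrite big_const_seq count_predT iter_addr_0 mulr_natl.
  apply: ler_sum => x _; rewrite sumrB lerB//.
    by rewrite sumr_const card_ffun !card_ord.
  rewrite -natr_sum ler_nat.
  have -> : (\sum_(g : {ffun 'I_N -> 'I_r}) (x + box_pt g \in s)%R =
    #|[pred g : {ffun 'I_N -> 'I_r} | (x + box_pt g \in s)%R]|)%N.
    rewrite -sum1_card [RHS]big_mkcond; apply: eq_bigr => g _.
    by rewrite inE; case: (_ \in s).
  rewrite cardE -(size_map (fun g => x + box_pt g)); apply: uniq_leq_size.
    by rewrite map_inj_uniq ?enum_uniq// => g h /addrI; exact: box_pt_inj.
  by move=> y /mapP[g]; rewrite mem_enum inE => gs ->.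
have rN : 0 < (r ^ N)%:R :> R.
  by rewrite ltr0n; apply: leq_trans hr; rewrite muln_gt0/= lt0n.
have hr' : 2 * n%:R <= (r ^ N)%:R :> R by rewrite -natrM ler_nat.
have := le_trans lo up.
set Q := (r ^ N)%:R in rN hr' *; set t := tv f.
have n0' : 0 <= n%:R :> R by [].
move=> h; rewrite -(ler_pM2l rN).
have -> : Q * (2 * N%:R * r%:R * t) = 2 * (Q * (N%:R * (r%:R * t))) by ring.
have : Q * n%:R <= 2 * (n%:R * (Q - n%:R)) by nra.
by move=> /le_trans; apply; rewrite ler_pM2l.
Qed.

(** The box of [box_isoperimetry] can be chosen with side at most
    [4 n^(1/N)]. *)
Lemma isoperimetry s : (1 < N)%N -> uniq s ->
  (size s)%:R `^ (1 - N%:R^-1) <= 8 * N%:R * tv (indic_seq s).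
Proof.
move=> N1 us; set n := size s.
have N1' : 1 < N%:R :> R by rewrite ltr1n.
have N0' : 0 < N%:R :> R by lra.
have Ni : N%:R^-1 < 1 :> R by rewrite invf_lt1.
have Ni0 : 0 < N%:R^-1 :> R by rewrite invr_gt0.
have rhs0 : 0 <= 8 * N%:R * tv (indic_seq s) by rewrite !mulr_ge0// tv_ge0.
have [n0|n0] := posnP n; first by rewrite n0 powR0//; lra.
have n1 : 1 <= n%:R :> R by rewrite ler1n.
(* the box side is the least integer above [(2 n)^(1/N)] *)
pose y : R := (2 * n%:R) `^ N%:R^-1.
have y1 : 1 <= y.
  by rewrite -(powRr0 (2 * n%:R)); apply: ler_powR; lra.
have y0 : 0 <= y by lra.
have /andP[ty yt] := truncn_itv y0.
set r := (Num.truncn y).+1 in yt.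
have ry : r%:R <= 2 * y :> R by rewrite /r -natr1; lra.
have hr : (2 * n <= r ^ N)%N.
  rewrite -(@ler_nat R) natrX natrM.
  have <- : y ^+ N = 2 * n%:R.
    by rewrite -powR_mulrn// /y powRVK ?gt_eqF//; lra.
  by apply: lerXn2r; rewrite ?nnegrE//; lra.
have yn : y <= 2 * n%:R `^ N%:R^-1.
  rewrite /y powRM//.
  apply: ler_wpM2r; first exact: powR_ge0.
  by rewrite -[leRHS]powRr1//; apply: ler_powR; lra.
have np : 0 < n%:R `^ N%:R^-1 :> R by rewrite powR_gt0; lra.
have := box_isoperimetry us hr.
rewrite -/n => h; rewrite powRB; last by rewrite pnatr_eq0 -lt0n n0 implybT.
rewrite powRr1// ler_pdivrMr//; apply: le_trans h _.
set t := tv _ in rhs0 *; have t0 : 0 <= t by exact: tv_ge0.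
have -> : 2 * N%:R * r%:R * t = r%:R * (2 * N%:R * t) by ring.
have -> : 8 * N%:R * t * n%:R `^ N%:R^-1 =
  4 * n%:R `^ N%:R^-1 * (2 * N%:R * t) by ring.
by apply: ler_wpM2r; [rewrite !mulr_ge0// ltW|lra].
Qed.

Lemma seq_argmin (s : seq ZN) f : s != [::] ->
  exists2 x0, x0 \in s & forall x, x \in s -> f x0 <= f x.
Proof.
elim: s => // a s IH _; have [->|/IH[b bs hb]] := eqVneq s [::].
  by exists a; rewrite ?mem_head// => x; rewrite inE => /eqP ->.
have [ab|ba] := leP (f a) (f b).
  exists a; first exact: mem_head.
  by move=> x; rewrite inE => /predU1P[->//|/hb]; exact: le_trans.
exists b; first by rewrite inE bs orbT.
by move=> x; rewrite inE => /predU1P[->|/hb//]; exact: ltW.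
Qed.

(** Peeling off the lowest layer of [w >= 0]: if [m] is the minimum of [w] on
    its support [A], then [w = m 1_A + w'] with [w' >= 0] of smaller support,
    and the total variation is additive along this splitting.  The norm on the
    left is subadditive by Minkowski's inequality, so that the claim reduces to
    the isoperimetric inequality for the layers. *)
Lemma sobolev_l1 w : (1 < N)%N -> finitely_supported w ->
  (forall x, 0 <= w x) ->
  fsum (fun x => w x `^ (N%:R / (N%:R - 1))) <=
    (8 * N%:R * tv w) `^ (N%:R / (N%:R - 1)).
Proof.
move=> N1; have N1' : 1 < N%:R :> R by rewrite ltr1n.
set a := N%:R / (N%:R - 1); have a1 : 1 <= a by rewrite /a ler_pdivlMr; lra.
have a0 : 0 < a by lra.
have aV : a^-1 = 1 - N%:R^-1 by rewrite /a; field; rewrite !gt_eqF//; lra.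
have C0 : 0 <= 8 * N%:R :> R by rewrite mulr_ge0.
move=> /finsuppP[s us].
have [n] := ubnP (size s); elim: n w s us => // n IH w s us sn w0 wge0.
pose A := [seq x <- s | w x != 0].
have uA : uniq A by rewrite filter_uniq.
have wA x : x \notin A -> w x = 0.
  by rewrite mem_filter negb_and negbK => /orP[/eqP//|/w0].
have [A0|An0] := eqVneq A [::].
  rewrite (fsumE uA) => [|x /wA ->]; last by rewrite powR0 ?gt_eqF.
  by rewrite A0 big_nil; exact: powR_ge0.
have [x0 x0A hx0] := seq_argmin w An0.
set m := w x0 in hx0.
have m0 : 0 < m.
  by move: x0A; rewrite mem_filter => /andP[wx0 _]; rewrite lt_neqAle eq_sym wx0 wge0.
pose w' x := w x - m * indic_seq A x.
have w'ge0 x : 0 <= w' x.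
  rewrite /w' /indic_seq; case: (boolP (x \in A)) => [/hx0|_].
    by rewrite mulr1 subr_ge0.
  by rewrite mulr0 subr0.
have uA' : uniq (rem x0 A) by rewrite rem_uniq.
have w'A x : x \notin rem x0 A -> w' x = 0.
  rewrite mem_rem_uniq// inE negb_and negbK => /orP[/eqP ->|xA].
    by rewrite /w' /indic_seq x0A mulr1 subrr.
  by rewrite /w' /indic_seq (negPf xA) (wA _ xA) mulr0 subrr.
have sA' : (size (rem x0 A) < n)%N.
  rewrite size_rem// -ltnS prednK; last by rewrite lt0n size_eq0.
  by rewrite (leq_ltn_trans _ sn)// size_filter count_size.
have hw' := IH w' _ uA' sA' w'A w'ge0.
have tvw : tv w = m * tv (indic_seq A) + tv w'.
  rewrite /tv mulr_sumr -big_split/=; apply: eq_bigr => i _.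
  rewrite -fsumZ -fsumD.
  - apply: eq_fsum => x; rewrite /pderiv /w' /indic_seq.
    case: (boolP (x \in A)) => [xA|/wA wx]; case: (boolP (x + gen i \in A)) => [yA|/wA wy].
    + by rewrite subrr normr0 mulr0 add0r; congr (`|_|); ring.
    + rewrite wy !(mulr0, mulr1, subr0, sub0r, oppr0) !normrN normr1 mulr1.
      by rewrite !ger0_norm ?subrKC ?subr_ge0 ?hx0.
    + rewrite wx !(mulr0, mulr1, subr0, sub0r, oppr0) normr1 mulr1.
      by rewrite !ger0_norm ?subrKC ?subr_ge0 ?hx0.
    + by rewrite wx wy !(mulr0, subr0) normr0 mulr0 addr0.
  - apply: (finsupp_sub (finsupp_norm (finsupp_pderiv i (finsupp_indic A)))).
    by move=> x ->; rewrite mulr0.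
  - apply: finsupp_norm; apply: finsupp_pderiv; apply/finsuppP.
    by exists (rem x0 A).
have hA : \sum_(x <- A) (m * indic_seq A x) `^ a <=
    (m * (8 * N%:R * tv (indic_seq A))) `^ a.
  rewrite powRM ?(ltW m0)//; last by rewrite mulr_ge0// tv_ge0.
  have -> : \sum_(x <- A) (m * indic_seq A x) `^ a = m `^ a * (size A)%:R.
    rewrite (eq_big_seq (fun=> m `^ a)) => [|x xA].
      by rewrite big_const_seq count_predT iter_addr_0 mulr_natr.
    by rewrite /indic_seq xA mulr1.
  rewrite ler_wpM2l ?powR_ge0//.
  rewrite -[leLHS](@powRVK _ _ a) ?gt_eqF//; apply: powR_le; first exact: ltW.
    exact: powR_ge0.
  by rewrite aV; exact: isoperimetry.
have hw'' : \sum_(x <- A) w' x `^ a <= (8 * N%:R * tv w') `^ a.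
  rewrite -fsumE// => x xA; rewrite w'A ?powR0 ?gt_eqF//.
  by apply: contra xA; exact: mem_rem.
rewrite (fsumE uA); last by move=> x /wA ->; rewrite powR0 ?gt_eqF.
rewrite tvw mulrDr mulrCA.
under eq_bigr => x _ do rewrite -[w x](subrKC (m * indic_seq A x)).
apply: minkowski_seq => //.
- by rewrite !mulr_ge0 ?tv_ge0// ltW.
- by rewrite !mulr_ge0 ?tv_ge0.
- by move=> x; rewrite mulr_ge0// ?(ltW m0)// /indic_seq.
Qed.

End Isoperimetry.

(** * Truncation and the first order Sobolev inequality *)

Section Truncation.
Context {R : realType}.
Implicit Types a e r x y : R.

Lemma cvg_normpow (F : nat -> R) (l r : R) : 1 <= r ->
  F n @[n --> \oo] --> l -> `|F n| `^ r @[n --> \oo] --> `|l| `^ r.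
Proof.
move=> r1 Fl; pose K := r * ((`|l| + 1) `^ (r - 1) + (`|l| + 1) `^ (r - 1)).
have K0 : 0 <= K by rewrite mulr_ge0 ?addr_ge0 ?powR_ge0//; lra.
have cK : K * `|l - F n| @[n --> \oo] --> 0.
  have -> : 0 = K * `|l - l| :> R by rewrite subrr normr0 mulr0.
  by apply: cvgMr; apply: cvg_norm; apply: cvgB => //; exact: cvg_cst.
apply/cvgrPdist_lt => e e0.
near=> m.
have F1 : `|l - F m| < 1 by near: m; exact: (cvgrPdist_lt _ _).1 Fl _ ltr01.
have Ke : K * `|l - F m| < e.
  suff : `|0 - K * `|l - F m| | < e by rewrite sub0r normrN ger0_norm// mulr_ge0.
  by near: m; exact: (cvgrPdist_lt _ _).1 cK _ e0.
apply: le_lt_trans Ke; apply: le_trans (powR_lipschitz _ _ r1) _.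
rewrite ler_wpM2r// ler_wpM2l//; first lra.
have := lerB_dist (F m) l; rewrite distrC => h.
have ln0 := normr_ge0 l; have Fn0 := normr_ge0 (F m).
by apply: lerD; apply: powR_le => //; lra.
Unshelve. all: by end_near. Qed.

(** Soft thresholding at height [e]. *)
Definition trunc e x : R := Num.max (x - e) 0 + Num.min (x + e) 0.

Lemma trunc_eq0 e x : `|x| <= e -> trunc e x = 0.
Proof.
rewrite ler_norml /trunc => /andP[h1 h2].
by case: (leP (x - e)) => ?; case: (leP (x + e)) => ?; lra.
Qed.

Lemma trunc_dist e x : 0 <= e -> `|x - trunc e x| <= e.
Proof.
move=> e0; rewrite ler_norml /trunc.
by case: (leP (x - e)) => ?; case: (leP (x + e)) => ?; lra.
Qed.

Lemma trunc_mono e x y : 0 <= e -> x <= y ->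
  0 <= trunc e y - trunc e x <= y - x.
Proof.
move=> e0 xy; rewrite /trunc; case: (leP (y - e)) => ?; case: (leP (x - e)) => ?;
  case: (leP (y + e)) => ?; case: (leP (x + e)) => ?; lra.
Qed.

Lemma trunc_lipschitz e x y : 0 <= e -> `|trunc e x - trunc e y| <= `|x - y|.
Proof.
move=> e0; wlog xy : x y / y <= x.
  move=> h; have [/h//|/ltW/h] := leP y x.
  by rewrite distrC (distrC y).
have /andP[h1 h2] := trunc_mono e0 xy.
by rewrite !ger0_norm// subr_ge0.
Qed.

Lemma cvg_trunc (F : nat -> R) x : (forall n, 0 <= F n) ->
  F n @[n --> \oo] --> 0 -> trunc (F n) x @[n --> \oo] --> x.
Proof.
move=> F0 Fc; apply/cvgrPdist_lt => e e0.
near=> m; apply: le_lt_trans (trunc_dist _ (F0 m)) _.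
suff : `|0 - F m| < e by rewrite sub0r normrN ger0_norm.
by near: m; exact: (cvgrPdist_lt _ _).1 Fc _ e0.
Unshelve. all: by end_near. Qed.

End Truncation.

Section Sobolev1.
Context {R : realType} {N : nat}.
Local Notation ZN := 'rV[int]_N.
Implicit Types (u f v w : ZN -> R) (B p : R).
Local Notation n := (N%:R : R).

Lemma finsupp_trunc (e : R) u : 0 < e -> vanishing u ->
  finitely_supported (fun x => trunc e (u x)).
Proof.
move=> e0 uv; apply: (sub_finite_set _ (uv _ e0)) => x /=.
by apply: contraNle => /ltW/trunc_eq0 ->.
Qed.

(** Fatou's lemma along the truncations at the levels [1 / (k + 1)]. *)
Lemma sums_le_trunc u (r B : R) : 1 <= r ->
  (forall e, 0 < e -> sums_le (fun x => `|trunc e (u x)| `^ r) B) ->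
  sums_le (fun x => `|u x| `^ r) B.
Proof.
move=> r1 uB; apply: (sums_le_lim (F := fun k x => `|trunc k.+1%:R^-1 (u x)| `^ r)).
  move=> x; apply: cvg_normpow => //; apply: (cvg_trunc (F := fun k => k.+1%:R^-1)).
    by move=> k; rewrite invr_ge0.
  exact: cvg_harmonic.
by move=> k; apply: uB; rewrite invr_gt0.
Qed.

Definition sobolev1_exp p : R := n * p / (n - p).

(** The l^1 inequality applied to [|u| ^ g] with [g = p (n - 1) / (n - p)]; by
    Hoelder's inequality its total variation is controlled by the product of
    the p-norm of the gradient and a power of the norm to be estimated, which
    is absorbed. *)
Lemma sobolev1_finsupp p : (1 < N)%N -> 1 <= p -> p < n ->
  exists2 C : R, 0 <= C & forall u B, finitely_supported u ->
    (forall i, sums_le (fun x => `|pderiv i u x| `^ p) B) ->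
    fsum (fun x => `|u x| `^ sobolev1_exp p) <= C * B `^ (sobolev1_exp p / p).
Proof.
move=> N1 p1 pn; have n1 : 1 < n by rewrite ltr1n.
set r := sobolev1_exp p.
pose g := p * (n - 1) / (n - p); pose a := n / (n - 1).
have np0 : 0 < n - p by lra.
have g1 : 1 <= g by rewrite /g ler_pdivlMr//; nra.
have g0 : 0 < g by lra.
have ga : g * a = r.
  by rewrite /g /a /r /sobolev1_exp; field; rewrite !gt_eqF//; lra.
have a0 : 0 < a by rewrite divr_gt0//; lra.
have r0 : 0 < r by rewrite -ga mulr_gt0.
pose K := 8 * n * ((2 * n) * (g * 2)).
have K0 : 0 <= K.
  have g20 : 0 <= g * 2 by lra.
  apply: mulr_ge0; first exact: mulr_ge0.
  by apply: mulr_ge0 g20; exact: mulr_ge0.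
exists (K `^ r); first exact: powR_ge0.
move=> u B fu hB; set X := fsum _.
have B0 : 0 <= B.
  by have := hB (Ordinal (ltnW N1), true) => /sums_le_ge0.
have fw : finitely_supported (fun x => `|u x| `^ g).
  by apply: finsupp_normpow; rewrite ?gt_eqF.
have fr : finitely_supported (fun x => `|u x| `^ r).
  by apply: finsupp_normpow; rewrite ?gt_eqF.
have X0 : 0 <= X by apply: fsum_ge0 => x; exact: powR_ge0.
have XX : sums_le (fun x => `|u x| `^ r) X.
  by apply: sums_le_fsum => // x; exact: powR_ge0.
have holder i y : sums_le (fun x => `|u (x + y)| `^ (g - 1) * `|pderiv i u x|)
    (B `^ p^-1 * X `^ (1 - p^-1)).
  have [p1'|pn1] := eqVneq p 1.
    have gE : g = 1 by rewrite /g p1'; field; rewrite gt_eqF//; lra.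
    rewrite gE p1' subrr invr1 subrr powRr0 mulr1 powRr1//.
    apply: (sums_le_mono (hB i)) => // x.
    by rewrite powRr0 mul1r p1' powRr1.
  have p1' : 1 < p by rewrite lt_neqAle eq_sym pn1.
  have qV : ((p / (p - 1))^-1 = 1 - p^-1) by field; rewrite !gt_eqF//; lra.
  rewrite mulrC -qV.
  apply: (@sums_hoelder _ _ (fun x => `|u (x + y)| `^ (g - 1)) _ (p / (p - 1)) p).
  - by rewrite divr_gt0; lra.
  - lra.
  - by rewrite qV subrK.
  - by move=> x; exact: powR_ge0.
  - by move=> x.
  - have -> : (fun x => (`|u (x + y)| `^ (g - 1)) `^ (p / (p - 1))) =
      (fun x => `|u (x + y)| `^ r).
      apply/funext => x; rewrite -powRrM; congr (_ `^ _).
      by rewrite /g /r /sobolev1_exp; field; rewrite !gt_eqF//; lra.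
    exact: (sums_le_shift y XX).
  - exact: hB.
have tvw : tv (fun x => `|u x| `^ g) <=
    (2 * n) * ((g * 2) * (B `^ p^-1 * X `^ (1 - p^-1))).
  rewrite /tv; apply: (@le_trans _ _ (\sum_(i : 'I_N * bool)
     (g * 2) * (B `^ p^-1 * X `^ (1 - p^-1)))); last first.
    rewrite sumr_const card_prod card_ord card_bool -[leLHS]mulr_natl.
    by rewrite natrM (mulrC n).
  apply: ler_sum => i _; apply: fsum_le_sums.
    exact: finsupp_norm (finsupp_pderiv i fw).
  have := sums_leZ (ltW g0) (sums_leD (holder i (gen i)) (holder i 0)).
  move=> /sums_le_mono; apply => [x|].
    apply: le_trans (powR_lipschitz _ _ g1) _.
    by rewrite addr0 -mulrDl mulrA.
  by rewrite le_eqVlt; apply/orP; left; apply/eqP; ring.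
have main : X `^ 1 <= (K * B `^ p^-1) `^ a * X `^ (a * (1 - p^-1)).
  have -> : X `^ (a * (1 - p^-1)) = (X `^ (1 - p^-1)) `^ a.
    by rewrite mulrC powRrM.
  rewrite -powRM ?powR_ge0//; last by rewrite mulr_ge0// powR_ge0.
  rewrite powRr1//.
  have XE : X = fsum (fun x => (`|u x| `^ g) `^ (N%:R / (N%:R - 1))).
    by apply: eq_fsum => x; rewrite -powRrM ga.
  rewrite [leLHS]XE; apply: le_trans (sobolev_l1 N1 fw _) _; first by move=> x; exact: powR_ge0.
  apply: powR_le; first exact: ltW.
    by rewrite !mulr_ge0// tv_ge0.
  apply: le_trans (ler_wpM2l _ tvw) _; first by rewrite mulr_ge0.
  by rewrite /K le_eqVlt; apply/orP; left; apply/eqP; ring.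
have p0 : 0 < p by lra.
have b1 : a * (1 - p^-1) < 1.
  have -> : a * (1 - p^-1) = (n * (p - 1)) / ((n - 1) * p).
    by rewrite /a; field; rewrite !gt_eqF//; lra.
  by rewrite ltr_pdivrMr ?mul1r ?mulr_gt0//; nra.
have := powR_absorb X0 (powR_ge0 _ _) b1 main.
rewrite -powRrM => /le_trans; apply.
have -> : a * (1 - a * (1 - p^-1))^-1 = r.
  rewrite /a /r /sobolev1_exp; field.
  by rewrite !gt_eqF//; lra.
by rewrite powRM ?powR_ge0// -powRrM (mulrC r) mulrC.
Qed.

(** Truncation at height [e] makes [u] finitely supported and does not increase
    its differences. *)
Theorem sobolev1 p : (1 < N)%N -> 1 <= p -> p < n ->
  exists2 C : R, 0 <= C & forall u B, vanishing u ->
    (forall i, sums_le (fun x => `|pderiv i u x| `^ p) B) ->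
    sums_le (fun x => `|u x| `^ sobolev1_exp p) (C * B `^ (sobolev1_exp p / p)).
Proof.
move=> N1 p1 pn; have [C C0 hC] := sobolev1_finsupp N1 p1 pn; exists C => //.
move=> u B uv hB; have r1 : 1 <= sobolev1_exp p.
  by rewrite /sobolev1_exp ler_pdivlMr; [nra|lra].
apply: sums_le_trunc => // e e0.
have fT := finsupp_trunc e0 uv.
have fr : finitely_supported (fun x => `|trunc e (u x)| `^ sobolev1_exp p).
  by apply: finsupp_normpow => //; rewrite gt_eqF//; lra.
apply: sums_le_mono (sums_le_fsum fr _) _ (hC _ B fT _) => //.
move=> i; apply: (sums_le_mono (hB i)) => // x.
by apply: powR_le => //; [lra|apply: trunc_lipschitz; exact: ltW].
Qed.

End Sobolev1.

(** * The second order Sobolev inequality for the Laplacian *)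

Section Energy.
Context {R : realType} {N : nat}.
Local Notation ZN := 'rV[int]_N.
Implicit Types (u f v w psi : ZN -> R) (B p : R) (i : 'I_N * bool).
Local Notation n := (N%:R : R).

Definition opp_gen i : 'I_N * bool := (i.1, ~~ i.2).

Lemma opp_genK : involutive opp_gen.
Proof. by case=> k b; rewrite /opp_gen /= negbK. Qed.

Lemma gen_opp i : gen (opp_gen i) = - gen i.
Proof. by case: i => k []; rewrite /gen /= ?opprK. Qed.

(** A translation turns each product with [g (x + gen i)] into one with [g x]
    and the opposite generator, so that every generator is counted twice. *)
Lemma summation_by_parts u g : finitely_supported g ->
  \sum_i fsum (fun x => pderiv i u x * pderiv i g x) =
  - 2 * fsum (fun x => laplacian u x * g x).
Proof.
move=> fg.
have fug i : finitely_supported (fun x => pderiv i u x * g x).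
  by apply: (finsupp_sub fg) => x ->; rewrite mulr0.
have half : \sum_i fsum (fun x => pderiv i u x * g x) =
    fsum (fun x => laplacian u x * g x).
  rewrite -(fsum_sum _ fug); apply: eq_fsum => x.
  by rewrite laplacianE mulr_suml.
have parts i : fsum (fun x => pderiv i u x * pderiv i g x) =
    - fsum (fun x => pderiv (opp_gen i) u x * g x) -
    fsum (fun x => pderiv i u x * g x).
  have fs' : finitely_supported (fun x => pderiv i u x * g (x + gen i)).
    by apply: (finsupp_sub (finsupp_shift (gen i) fg)) => x ->; rewrite mulr0.
  transitivity (fsum (fun x => pderiv i u x * g (x + gen i) - pderiv i u x * g x)).
    by apply: eq_fsum => x; rewrite -mulrBr.
  rewrite fsumB//; congr (_ - _).
  rewrite -(fsum_shift _ (- gen i)) -fsumN; apply: eq_fsum => x.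
  by rewrite subrK -mulNr /pderiv gen_opp subrK opprB.
rewrite (eq_bigr _ (fun i _ => parts i)) sumrB sumrN.
have -> : \sum_i fsum (fun x => pderiv (opp_gen i) u x * g x) =
    \sum_i fsum (fun x => pderiv i u x * g x).
  by rewrite [RHS](reindex_inj (inv_inj opp_genK)).
by rewrite half; ring.
Qed.

(** The energy estimate behind the Sobolev inequality: [- Delta psi] is tested
    against the signed power [|v| ^ (s - 1)] of a truncation [v] of [psi] with
    [s = (n - 2) p / (n - 2 p)].  By the Stroock-Varopoulos inequality this
    controls the gradient of [|v| ^ (s / 2)] in l^2, hence by the first order
    inequality a power of the norm of [v]; the choice of [s] makes Hoelder's
    inequality on the other side produce the same norm, to a smaller power. *)
Theorem sobolev_laplacian p : (2 < N)%N -> 1 < p -> p < n / 2 ->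
  exists2 C : R, 0 <= C & forall psi B, vanishing psi ->
    sums_le (fun x => `|laplacian psi x| `^ p) B ->
    sums_le (fun x => `|psi x| `^ @sobolev_exp R N p)
      (C * B `^ (@sobolev_exp R N p / p)).
Proof.
move=> N2 p1 pn; have n2 : 2 < n by rewrite ltr_nat.
have p0 : 0 < p by lra.
have d0 : 0 < n - 2 * p by lra.
set q := @sobolev_exp R N p.
pose s := (n - 2) * p / (n - 2 * p); pose m := n / (n - 2).
have s1 : 1 < s by rewrite /s ltr_pdivlMr//; nra.
have q1 : 1 <= q by rewrite /q /sobolev_exp ler_pdivlMr//; nra.
have m0 : 0 < m by rewrite divr_gt0//; lra.
have [K K0 hK] := stroock_varopoulos s1.
have [|||C2 C20 hC2] := @sobolev1_finsupp R N 2; [by apply: ltn_trans N2|lra|lra|].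
have e2 : @sobolev1_exp R N 2 = s^-1 * 2 * q.
  rewrite /sobolev1_exp /s /q /sobolev_exp; field.
  by rewrite !gt_eqF//; lra.
pose K2 : R := 2 * K; have K20 : 0 < K2 by rewrite mulr_gt0.
exists ((C2 * K2 `^ m) `^ (q / m)); first exact: powR_ge0.
move=> psi B psiv hB; apply: sums_le_trunc => // e e0.
have e0' := ltW e0.
set v := fun x => trunc e (psi x).
have fv : finitely_supported v := finsupp_trunc e0 psiv.
have fq : finitely_supported (fun x => `|v x| `^ q).
  by apply: finsupp_normpow => //; rewrite gt_eqF//; lra.
set X := fsum (fun x => `|v x| `^ q).
have XX : sums_le (fun x => `|v x| `^ q) X.
  by apply: sums_le_fsum => // x; exact: powR_ge0.
apply: (sums_le_mono XX) => //.
have X0 : 0 <= X by apply: fsum_ge0 => x; exact: powR_ge0.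
have B0 := sums_le_ge0 hB.
pose g x := spow (s - 1) (v x).
have fg : finitely_supported g.
  by apply: (finsupp_sub fv) => x; rewrite /g => ->; rewrite spow0.
have s10 : 0 < s - 1 by lra.
pose w x := `|v x| `^ (s / 2).
have fw : finitely_supported w by apply: finsupp_normpow => //; rewrite gt_eqF//; lra.
(* both truncation and the signed power are increasing, so replacing [v] by
   [psi] in the first factor only increases the product *)
have wg i x : pderiv i w x ^+ 2 <= K * (pderiv i psi x * pderiv i g x).
  apply: le_trans (hK (v (x + gen i)) (v x)) _; rewrite ler_pM2l// /pderiv.
  rewrite -/(g x) -/(g (x + gen i)).
  have [xy|/ltW xy] := leP (psi x) (psi (x + gen i)).
    have /andP[h1 h2] := trunc_mono e0' xy.
    by rewrite ler_wpM2r// subr_ge0 spow_le// -subr_ge0.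
  have /andP[h1 h2] := trunc_mono e0' xy.
  rewrite -mulrNN -[leRHS]mulrNN !opprB.
  by rewrite ler_wpM2r// subr_ge0 spow_le// -subr_ge0.
pose A := \sum_i fsum (fun x => pderiv i w x ^+ 2).
have fw2 i : finitely_supported (fun x => pderiv i w x ^+ 2).
  by apply: (finsupp_sub (finsupp_pderiv i fw)) => x ->; rewrite expr0n.
have AX : A <= K2 * (B `^ p^-1 * X `^ (1 - p^-1)).
  have fpg i : finitely_supported (fun x => pderiv i psi x * pderiv i g x).
    by apply: (finsupp_sub (finsupp_pderiv i fg)) => x ->; rewrite mulr0.
  apply: (@le_trans _ _ (K * \sum_i fsum (fun x => pderiv i psi x * pderiv i g x))).
    rewrite mulr_sumr; apply: ler_sum => i _; rewrite -fsumZ; apply: fsum_le => //.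
    by apply: (finsupp_sub (fpg i)) => x ->; rewrite mulr0.
  rewrite summation_by_parts//.
  have -> : K * (- 2 * fsum (fun x => laplacian psi x * g x)) =
      K2 * - fsum (fun x => laplacian psi x * g x) by rewrite /K2; ring.
  rewrite -fsumN ler_pM2l//; apply: fsum_le_sums.
    by apply: (finsupp_sub fg) => x ->; rewrite mulr0 oppr0.
  have qV : ((p / (p - 1))^-1 = 1 - p^-1) by field; rewrite !gt_eqF//; lra.
  have := @sums_hoelder _ _ (fun x => `|laplacian psi x|) (fun x => `|g x|)
    p (p / (p - 1)) B X.
  rewrite qV subrKC => /(_ p0) h.
  have {}h := h (divr_gt0 p0 (ltac:(lra) : 0 < p - 1)) erefl.
  have {}h := h (fun x => normr_ge0 _) (fun x => normr_ge0 _) hB.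
  have := h _; have -> : (fun x => `|g x| `^ (p / (p - 1))) = (fun x => `|v x| `^ q).
    apply/funext => x; rewrite norm_spow// -powRrM; congr (_ `^ _).
    by rewrite /s /q /sobolev_exp; field; rewrite !gt_eqF//; lra.
  move=> /(_ XX)/sums_le_mono; apply => // x.
  by rewrite -normrM -normrN; exact: ler_norm.
have main : X `^ 1 <= C2 * K2 `^ m * B `^ (m / p) * X `^ (m * (1 - p^-1)).
  rewrite powRr1//.
  have XE : X = fsum (fun x => `|w x| `^ @sobolev1_exp R N 2).
    apply: eq_fsum => x; rewrite /w (ger0_norm (powR_ge0 _ _)) -powRrM e2; congr (_ `^ _).
    by field; rewrite gt_eqF//; lra.
  rewrite [leLHS]XE; apply: le_trans (hC2 w A fw _) _.
    move=> i; apply: (sums_le_mono (sums_le_fsum (fw2 i) _)).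
    - by move=> x; exact: sqr_ge0.
    - by move=> x; rewrite powR_mulrn// real_normK// num_real.
    - rewrite /A (bigD1 i)//= lerDl; apply: sumr_ge0 => j _; apply: fsum_ge0 => x.
      exact: sqr_ge0.
  have -> : @sobolev1_exp R N 2 / 2 = m.
    by rewrite /sobolev1_exp /m; field; rewrite gt_eqF//; lra.
  have -> : B `^ (m / p) = (B `^ p^-1) `^ m by rewrite mulrC powRrM.
  have -> : X `^ (m * (1 - p^-1)) = (X `^ (1 - p^-1)) `^ m by rewrite mulrC powRrM.
  rewrite -2!mulrA ler_wpM2l//.
  rewrite -!powRM ?mulr_ge0 ?powR_ge0 ?(ltW K0)//.
  apply: powR_le AX; first exact: ltW.
  by apply: sumr_ge0 => i _; apply: fsum_ge0 => x; exact: sqr_ge0.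
have b1 : m * (1 - p^-1) < 1.
  have -> : m * (1 - p^-1) = (n * (p - 1)) / ((n - 2) * p).
    by rewrite /m; field; rewrite !gt_eqF//; lra.
  have n20 : 0 < n - 2 by lra.
  by rewrite ltr_pdivrMr ?mul1r ?mulr_gt0//; nra.
have c0 : 0 <= C2 * K2 `^ m by rewrite mulr_ge0 ?powR_ge0.
have := powR_absorb X0 (mulr_ge0 c0 (powR_ge0 _ _)) b1 main.
move=> /le_trans; apply.
have -> : (1 - m * (1 - p^-1))^-1 = q / m.
  rewrite /m /q /sobolev_exp; field.
  by rewrite !gt_eqF//; lra.
rewrite (powRM _ c0 (powR_ge0 _ _)) -(powRrM B).
rewrite le_eqVlt; apply/orP; left; apply/eqP; congr (_ * _ `^ _).
by field; rewrite !gt_eqF.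
Qed.

End Energy.

(** * Laplacians of finitely supported functions are dense in l^p *)

Section Density.
Context {R : realType} {N : nat}.
Local Notation ZN := 'rV[int]_N.
Implicit Types (u f v w phi : ZN -> R) (B p : R) (i : 'I_N * bool).
Local Notation n := (N%:R : R).

Lemma laplacianD u v x :
  laplacian (fun y => u y + v y) x = laplacian u x + laplacian v x.
Proof.
rewrite !laplacianE -big_split/=; apply: eq_bigr => i _.
by rewrite /pderiv; ring.
Qed.

Lemma laplacianZ (c : R) u x :
  laplacian (fun y => c * u y) x = c * laplacian u x.
Proof.
rewrite !laplacianE mulr_sumr; apply: eq_bigr => i _.
by rewrite /pderiv; ring.
Qed.

Lemma laplacianB u v x :
  laplacian (fun y => u y - v y) x = laplacian u x - laplacian v x.
Proof.
rewrite !laplacianE -sumrB; apply: eq_bigr => i _.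
by rewrite /pderiv; ring.
Qed.

Lemma finsupp_laplacian u : finitely_supported u ->
  finitely_supported (laplacian u).
Proof.
move=> fu; have := finsupp_sum (index_enum _) xpredT (fun i => finsupp_pderiv i fu).
by move=> /finsupp_sub; apply => x; rewrite laplacianE.
Qed.

(** The transition operator of the simple random walk. *)
Definition walk u x : R := (\sum_i u (x + gen i)) / (2 * n).

Lemma finsupp_walk u : finitely_supported u -> finitely_supported (walk u).
Proof.
move=> fu.
have := finsupp_sum (index_enum _) xpredT (fun i => finsupp_shift (gen i) fu).
by move=> /finsupp_sub; apply => x; rewrite /walk => ->; rewrite mul0r.
Qed.

Lemma walk_contract u : (0 < N)%N -> finitely_supported u ->
  fsum (fun x => `|walk u x|) <= fsum (fun x => `|u x|).
Proof.
move=> N0 fu; have n0 : 0 < 2 * n by rewrite mulr_gt0// ltr0n.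
have fi i : finitely_supported (fun x => `|u (x + gen i)|).
  exact: finsupp_norm (finsupp_shift (gen i) fu).
have fS := finsupp_sum (index_enum _) xpredT fi.
apply: (@le_trans _ _ (fsum (fun x => (2 * n)^-1 * \sum_i `|u (x + gen i)|))).
  apply: fsum_le => [||x].
  - exact: finsupp_norm (finsupp_walk fu).
  - by apply: (finsupp_sub fS) => x ->; rewrite mulr0.
  - rewrite /walk normrM mulrC ger0_norm ?invr_ge0 ?(ltW n0)//.
    by rewrite ler_wpM2l ?invr_ge0 ?(ltW n0)// ler_norm_sum.
rewrite fsumZ (fsum_sum _ fi).
under eq_bigr do rewrite (fsum_shift (fun x => `|u x|)).
rewrite sumr_const card_prod card_ord card_bool -[X in _ * X]mulr_natl natrM.
by rewrite (mulrC n) mulKf// gt_eqF.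
Qed.

Lemma laplacian_walk u x : (0 < N)%N ->
  laplacian u x = 2 * n * (walk u x - u x).
Proof.
move=> N0; have n0 : 0 < n by rewrite ltr0n.
rewrite laplacianE /pderiv /walk sumrB sumr_const card_prod card_ord card_bool.
rewrite -[X in _ - X]mulr_natl natrM; field.
by rewrite gt_eqF.
Qed.

Definition walk_sum u m x : R := \sum_(k < m) iter k walk u x.

(** A discrete primitive of [walk_sum]: its Laplacian telescopes to
    [walk_sum] minus a multiple of [u]. *)
Definition walk_sum2 u m x : R := \sum_(j < m) walk_sum u j x.

Lemma finsupp_iter_walk u k : finitely_supported u ->
  finitely_supported (iter k walk u).
Proof. by move=> fu; elim: k => //= k; exact: finsupp_walk. Qed.

Lemma walk_iter_contract u k : (0 < N)%N -> finitely_supported u ->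
  fsum (fun x => `|iter k walk u x|) <= fsum (fun x => `|u x|).
Proof.
move=> N0 fu; elim: k => //= k IH; apply: le_trans IH.
exact: walk_contract (finsupp_iter_walk k fu).
Qed.

Lemma laplacian_walk_sum u m x : (0 < N)%N ->
  laplacian (walk_sum u m) x = 2 * n * (iter m walk u x - u x).
Proof.
move=> N0; elim: m => [|m IH].
  rewrite subrr mulr0 laplacianE big1// => i _.
  by rewrite /pderiv /walk_sum !big_ord0 subrr.
have -> : walk_sum u m.+1 = (fun y => walk_sum u m y + iter m walk u y).
  by apply/funext => y; rewrite /walk_sum big_ord_recr.
by rewrite laplacianD IH laplacian_walk//= -mulrDr; congr (_ * _); ring.
Qed.

Lemma laplacian_walk_sum2 u m x : (0 < N)%N ->
  laplacian (walk_sum2 u m) x = 2 * n * (walk_sum u m x - m%:R * u x).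
Proof.
move=> N0; elim: m => [|m IH].
  rewrite /walk_sum big_ord0 mul0r subrr mulr0 laplacianE big1// => i _.
  by rewrite /pderiv /walk_sum2 !big_ord0 subrr.
have -> : walk_sum2 u m.+1 = (fun y => walk_sum2 u m y + walk_sum u m y).
  by apply/funext => y; rewrite /walk_sum2 big_ord_recr.
rewrite laplacianD IH laplacian_walk_sum//= -mulrDr; congr (_ * _).
by rewrite /walk_sum big_ord_recr/= -natr1; ring.
Qed.

Lemma finsupp_walk_sum u m : finitely_supported u ->
  finitely_supported (walk_sum u m).
Proof. by move=> fu; apply: finsupp_sum => k; exact: finsupp_iter_walk. Qed.

Lemma finsupp_walk_sum2 u m : finitely_supported u ->
  finitely_supported (walk_sum2 u m).
Proof. by move=> fu; apply: finsupp_sum => k; exact: finsupp_walk_sum. Qed.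

Lemma fsum_walk_sum u m : (0 < N)%N -> finitely_supported u ->
  fsum (fun x => `|walk_sum u m x|) <= m%:R * fsum (fun x => `|u x|).
Proof.
move=> N0 fu.
have fi (k : 'I_m) : finitely_supported (fun x => `|iter k walk u x|).
  exact: finsupp_norm (finsupp_iter_walk k fu).
apply: (@le_trans _ _ (fsum (fun x => \sum_(k < m) `|iter k walk u x|))).
  apply: fsum_le => [||x].
  - exact: finsupp_norm (finsupp_walk_sum m fu).
  - exact: finsupp_sum.
  - exact: ler_norm_sum.
rewrite fsum_sum//; apply: (@le_trans _ _ (\sum_(k < m) fsum (fun x => `|u x|))).
  by apply: ler_sum => k _; exact: walk_iter_contract.
by rewrite sumr_const card_ord -[leLHS]mulr_natl.
Qed.

Lemma sums_le_interpolate f p (S M : R) : 1 < p -> finitely_supported f ->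
  (forall x, `|f x| <= S) -> fsum (fun x => `|f x|) <= M ->
  sums_le (fun x => `|f x| `^ p) (S `^ (p - 1) * M).
Proof.
move=> p1 ff fS fM.
have S0 : 0 <= S by apply: le_trans (fS 0).
have := sums_leZ (powR_ge0 S (p - 1)) (sums_le_fsum (finsupp_norm ff) (fun x => normr_ge0 (f x))).
move=> /sums_le_mono; apply => [x|]; last by rewrite ler_wpM2l ?powR_ge0.
rewrite -mulr_powRB1//; last lra.
by rewrite mulrC ler_wpM2r// powR_le//; lra.
Qed.

(** With [h = 1/m (f + P f + .. + P^(m-1) f)], [P] the transition operator,
    [f - h] is the Laplacian of a finitely supported function, while the
    Laplacian of [h] is of order [1/m] in l^1.  Hence [h] tends to [0] in l^q by
    the Sobolev inequality, so uniformly, and being bounded in l^1 it tends to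
    [0] in l^p for [p > 1]. *)
Lemma laplacian_dense_finsupp p f (e : R) :
  (2 < N)%N -> 1 < p -> p < n / 2 -> finitely_supported f -> 0 < e ->
  exists2 phi, finitely_supported phi &
    sums_le (fun x => `|laplacian phi x - f x| `^ p) e.
Proof.
move=> N2 p1 pn ff e0; have N0 : (0 < N)%N by apply: leq_trans N2.
have n2 : 2 < n by rewrite ltr_nat.
have [C C0 hC] := sobolev_laplacian N2 p1 pn.
set q := @sobolev_exp R N p in hC.
have q0 : 0 < q by rewrite /q /sobolev_exp divr_gt0//; nra.
set M := fsum (fun x => `|f x|).
have M0 : 0 <= M by apply: fsum_ge0 => x.
(* [c / m] bounds the mean [h] uniformly; [m] is so large that it is below [d] *)
pose c := C `^ q^-1 * (4 * n * M).
pose d := (e / (M + 1)) `^ (p - 1)^-1.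
have d0 : 0 < d by rewrite powR_gt0// divr_gt0//; lra.
have c0 : 0 <= c by rewrite mulr_ge0 ?powR_ge0// mulr_ge0//; lra.
pose m := (Num.truncn (c / d)).+1.
have m0 : 0 < m%:R :> R by rewrite ltr0n.
have cm : c / m%:R <= d.
  have /andP[_] := truncn_itv (divr_ge0 c0 (ltW d0)).
  by rewrite -/m ltr_pdivrMr// => /ltW; rewrite ler_pdivrMr// mulrC.
pose h x := m%:R^-1 * walk_sum f m x.
have fh : finitely_supported h.
  by apply: (finsupp_sub (finsupp_walk_sum m ff)) => x hx; rewrite /h hx mulr0.
have hM : fsum (fun x => `|h x|) <= M.
  have -> : fsum (fun x => `|h x|) = m%:R^-1 * fsum (fun x => `|walk_sum f m x|).
    rewrite -fsumZ; apply: eq_fsum => x.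
    by rewrite /h normrM ger0_norm// invr_ge0.
  by rewrite ler_pdivrMl//; exact: fsum_walk_sum.
exists (fun x => - (2 * n * m%:R)^-1 * walk_sum2 f m x).
  by apply: (finsupp_sub (finsupp_walk_sum2 m ff)) => x ->; rewrite mulr0.
have hE x : laplacian (fun x => - (2 * n * m%:R)^-1 * walk_sum2 f m x) x - f x = - h x.
  rewrite laplacianZ laplacian_walk_sum2// /h; field.
  by rewrite !gt_eqF//; lra.
pose D := 4 * n * M / m%:R.
have lhE x : laplacian h x = m%:R^-1 * (2 * n) * (iter m walk f x - f x).
  by rewrite laplacianZ laplacian_walk_sum// mulrA.
have flh : finitely_supported (laplacian h) by exact: finsupp_laplacian.
have lhD : fsum (fun x => `|laplacian h x|) <= D.
  have fm := finsupp_norm (finsupp_iter_walk m ff).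
  apply: (@le_trans _ _ (fsum (fun x => m%:R^-1 * (2 * n) * (`|iter m walk f x| + `|f x|)))).
    apply: fsum_le => [||x].
    - exact: finsupp_norm.
    - apply: (finsupp_sub2 fm (finsupp_norm ff)) => x -> ->.
      by rewrite addr0 mulr0.
    - rewrite lhE normrM ger0_norm ?mulr_ge0 ?invr_ge0//.
      by rewrite ler_wpM2l ?mulr_ge0 ?invr_ge0// ler_normB.
  rewrite fsumZ fsumD//; last exact: finsupp_norm.
  apply: (@le_trans _ _ (m%:R^-1 * (2 * n) * (M + M))).
    rewrite ler_wpM2l ?mulr_ge0 ?invr_ge0// lerD2r.
    exact: walk_iter_contract.
  by rewrite /D le_eqVlt; apply/orP; left; apply/eqP; ring.
have lhp : sums_le (fun x => `|laplacian h x| `^ p) (D `^ p).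
  have D0 : 0 <= D by apply: le_trans lhD; apply: fsum_ge0.
  rewrite -mulr_powRB1//; last lra.
  rewrite mulrC; apply: sums_le_interpolate => // x.
  apply: le_trans lhD.
  exact: (sums_le_point x (sums_le_fsum (finsupp_norm flh) (fun x => normr_ge0 _))).
have hinf x : `|h x| <= c / m%:R.
  have := sums_le_point x (hC h _ (vanishing_finsupp fh) lhp).
  have p0 : p != 0 by rewrite gt_eqF//; lra.
  have -> : (D `^ p) `^ (q / p) = D `^ q by rewrite -powRrM mulrC divfK.
  move=> hx; rewrite -[leLHS](@powRK _ _ q) ?gt_eqF//.
  apply: le_trans (powR_le _ _ hx) _; rewrite ?invr_ge0 ?powR_ge0 ?(ltW q0)//.
  have D0 : 0 <= D by apply: le_trans lhD; apply: fsum_ge0.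
  rewrite powRM ?powR_ge0// powRK ?gt_eqF//.
  by rewrite /c /D !mulrA.
have := sums_le_interpolate p1 fh hinf hM.
move=> /sums_le_mono; apply => [x|]; first by rewrite hE normrN.
apply: (@le_trans _ _ (d `^ (p - 1) * M)).
  rewrite ler_wpM2r//; apply: powR_le => //; first lra.
  by rewrite divr_ge0// ltW.
rewrite /d powRVK ?divr_ge0//; [|lra|lra|by rewrite gt_eqF//; lra].
rewrite mulrAC ler_pdivrMr; last lra.
by rewrite ler_wpM2l//; lra.
Qed.

(** The Laplacian of [u] is first replaced by its restriction to a finite
    set. *)
Lemma laplacian_dense p u B (e : R) :
  (2 < N)%N -> 1 < p -> p < n / 2 -> 0 < e ->
  sums_le (fun x => `|laplacian u x| `^ p) B ->
  exists2 phi, finitely_supported phi &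
    sums_le (fun x => `|laplacian (fun y => u y - phi y) x| `^ p) e.
Proof.
move=> N2 p1 pn e0 uB; pose d := e / (2 `^ p * 2).
have p20 : 0 < 2 `^ p :> R by rewrite powR_gt0.
have d0 : 0 < d by rewrite divr_gt0// mulr_gt0.
have [s us hs] := sums_tail (fun x => powR_ge0 `|laplacian u x| p) uB d0.
pose f x := if x \in s then laplacian u x else 0.
have ff : finitely_supported f.
  by apply/finsuppP; exists s => // x; rewrite /f => /negPf ->.
have [phi fphi hphi] := laplacian_dense_finsupp N2 p1 pn ff d0.
exists phi => //.
have tail : sums_le (fun x => `|laplacian u x - f x| `^ p) d.
  apply: (sums_le_mono hs) => // x; rewrite /f; case: ifP => _; last by rewrite subr0.
  by rewrite subrr normr0 powR0// gt_eqF//; lra.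
have hphi' : sums_le (fun x => `|f x - laplacian phi x| `^ p) d.
  by apply: (sums_le_mono hphi) => // x; rewrite distrC.
have p0 : 0 <= p by lra.
apply: (sums_le_mono (sums_le_powD p0 tail hphi')) => [x|].
  by rewrite laplacianB subrKA.
rewrite /d le_eqVlt; apply/orP; left; apply/eqP; field.
by rewrite gt_eqF.
Qed.

End Density.

(** * Completions for seminorms with a Sobolev inequality *)

Section EnergyNorm.
Context {R : realType} {N : nat} {J : finType}.
Local Notation ZN := 'rV[int]_N.
Context (L : J -> (ZN -> R) -> ZN -> R).
Implicit Types (u v phi : ZN -> R) (B p q e d : R).

(** The common form of the two norms of the theorem: a finite family of
    difference operators measured in l^p. *)
Definition energy_norm p u : \bar R :=
  ((\sum_j \esum_(x in [set: ZN]) (`|L j u x| `^ p)%:E) `^ p^-1)%E.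

Lemma energy_norm_lt1 p u j : 0 < p -> (energy_norm p u < 1%:E)%E ->
  sums_le (fun x => `|L j u x| `^ p) 1.
Proof.
move=> p0; rewrite /energy_norm; set S := (\sum_j _)%E => S1.
have S0 : (0 <= S)%E.
  by apply: sume_ge0 => i _; apply: esum_ge0 => x _; rewrite lee_fin powR_ge0.
apply/sums_leP; first by move=> x; exact: powR_ge0.
apply: (@le_trans _ _ S).
  rewrite /S (bigD1 j)//= leeDl// sume_ge0// => i _; apply: esum_ge0 => x _.
  by rewrite lee_fin powR_ge0.
case: S S0 S1 => [s| |]//=.
- rewrite !lee_fin lte_fin => s0 s1.
  rewrite -(@powRVK _ s p)//; last by rewrite gt_eqF.
  have := powR_le (ltW p0) (powR_ge0 _ _) (ltW s1).
  by rewrite powR1.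
- by rewrite invr_eq0 gt_eqF.
Qed.

Lemma energy_norm_lty p u : 0 < p ->
  (energy_norm p u < +oo)%E <->
  exists B, forall j, sums_le (fun x => `|L j u x| `^ p) B.
Proof.
move=> p0; have pw j x : 0 <= `|L j u x| `^ p by exact: powR_ge0.
have e0 j : (0 <= \esum_(x in [set: ZN]) (`|L j u x| `^ p)%:E)%E.
  by apply: esum_ge0 => x _; rewrite lee_fin.
rewrite /energy_norm; split=> [Sy|[B hB]].
  have {}Sy : (\sum_j \esum_(x in [set: ZN]) (`|L j u x| `^ p)%:E < +oo)%E.
    by apply: lty_poweRy Sy; rewrite invr_eq0 gt_eqF.
  exists (fine (\sum_j \esum_(x in [set: ZN]) (`|L j u x| `^ p)%:E)%E) => j.
  apply/sums_leP => //; rewrite fineK; last first.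
    by rewrite ge0_fin_numE// sume_ge0.
  by rewrite (bigD1 j)//= leeDl// sume_ge0.
apply: poweR_lty; apply: (@le_lt_trans _ _ (\sum_(j : J) B%:E)%E).
  by apply: lee_sum => j _; apply/sums_leP.
by rewrite sumEFin ltry.
Qed.

Lemma energy_norm_small p e : 0 < p -> 0 < e ->
  exists2 d, 0 < d & forall u,
    (forall j, sums_le (fun x => `|L j u x| `^ p) d) ->
    (energy_norm p u < e%:E)%E.
Proof.
move=> p0 e0; pose d := (e / 2) `^ p / (#|J|%:R + 1).
have J0 : 0 < #|J|%:R + 1 :> R by rewrite ltr_wpDl.
have ep0 : 0 < (e / 2) `^ p by rewrite powR_gt0//; lra.
exists d; first by rewrite divr_gt0.
move=> u hu; rewrite /energy_norm; set S := (\sum_j _)%E.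
have S0 : (0 <= S)%E.
  by apply: sume_ge0 => i _; apply: esum_ge0 => x _; rewrite lee_fin powR_ge0.
have Sd : (S <= ((e / 2) `^ p)%:E)%E.
  apply: (@le_trans _ _ (\sum_(j : J) d%:E)%E).
    apply: lee_sum => j _; apply/sums_leP; last exact: hu.
    by move=> x; exact: powR_ge0.
  rewrite sumEFin lee_fin sumr_const -[leLHS]mulr_natl /d mulrCA.
  by rewrite -[leRHS]mulr1 ler_wpM2l ?(ltW ep0)// ler_pdivrMr// mul1r lerDl.
case: S S0 Sd => [s| |]//=; rewrite !lee_fin lte_fin => s0 sd.
have p10 : 0 <= p^-1 by rewrite invr_ge0 ltW.
apply: le_lt_trans (powR_le p10 s0 sd) _.
by rewrite powRK ?gt_eqF//; lra.
Qed.

Lemma lnorm_lty q u : 0 < q ->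
  (lnorm q u < +oo)%E <-> exists B, sums_le (fun x => `|u x| `^ q) B.
Proof.
move=> q0; have pw x : 0 <= `|u x| `^ q by exact: powR_ge0.
rewrite -(esum_ltyP pw) /lnorm; split => [|Sy]; last exact: poweR_lty.
by apply: lty_poweRy; rewrite invr_eq0 gt_eqF.
Qed.

(** A limit of a Cauchy sequence inherits the Sobolev inequality by Fatou's
    lemma.  Conversely approximations of [u] in the seminorm converge pointwise
    because the Sobolev inequality also applies to their differences with [u],
    which are not finitely supported but vanish at infinity. *)
Theorem completion_energy_norm p q (C : R) : 1 <= p -> 1 <= q -> 0 <= C ->
  (forall j u v x, L j (fun y => u y - v y) x = L j u x - L j v x) ->
  (forall j (F : nat -> ZN -> R) u x,
    (forall y, F k y @[k --> \oo] --> u y) ->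
    L j (F k) x @[k --> \oo] --> L j u x) ->
  (forall j phi, finitely_supported phi -> finitely_supported (L j phi)) ->
  (forall u B, vanishing u -> (forall j, sums_le (fun x => `|L j u x| `^ p) B) ->
    sums_le (fun x => `|u x| `^ q) (C * B `^ (q / p))) ->
  (forall u A B e, 0 < e -> sums_le (fun x => `|u x| `^ q) A ->
    (forall j, sums_le (fun x => `|L j u x| `^ p) B) ->
    exists2 phi, finitely_supported phi &
      forall j, sums_le (fun x => `|L j (fun y => u y - phi y) x| `^ p) e) ->
  completion (energy_norm p) =
  [set u | (lnorm q u < +oo)%E /\ (energy_norm p u < +oo)%E].
Proof.
move=> p1 q1 C0 LB Lcvg Lfs sobolev dense.
have p0 : 0 < p by lra.
have q0 : 0 < q by lra.
apply/seteqP; split=> u.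
  move=> [phi [phifs cauchy phiu]].
  have [n0 hn0] := cauchy 1 ltr01.
  pose b j := fsum (fun x => `|L j (phi n0) x| `^ p).
  have hb j : sums_le (fun x => `|L j (phi n0) x| `^ p) (b j).
    apply: sums_le_fsum => [|x]; last exact: powR_ge0.
    apply: finsupp_normpow; last exact: Lfs.
    by rewrite gt_eqF.
  have b0 j : 0 <= b j by exact: sums_le_ge0 (hb j).
  pose B := 2 `^ p * (1 + \sum_j b j).
  pose F k := phi (k + n0)%N.
  have Fu x : F k x @[k --> \oo] --> u x by rewrite /F (cvg_shiftn n0 (phi^~ x)).
  have FB j k : sums_le (fun x => `|L j (F k) x| `^ p) B.
    have := hn0 (k + n0)%N n0 (leq_addl _ _) (leqnn _).
    move=> /(energy_norm_lt1 j p0) h1.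
    apply: (sums_le_mono (sums_le_powD (ltW p0) h1 (hb j))) => [x|].
      by rewrite LB subrK.
    rewrite ler_wpM2l ?powR_ge0// lerD2l (bigD1 j)//= lerDl.
    by apply: sumr_ge0.
  split.
    apply/(lnorm_lty u q0); exists (C * B `^ (q / p)).
    apply: (sums_le_lim (F := fun k x => `|F k x| `^ q)) => [x|k].
      exact: cvg_normpow.
    by apply: sobolev => [|j]; [apply: vanishing_finsupp; exact: phifs|exact: FB].
  apply/(energy_norm_lty u p0); exists B => j.
  apply: (sums_le_lim (F := fun k x => `|L j (F k) x| `^ p)) => [x|k].
    by apply: cvg_normpow => //; apply: Lcvg.
  exact: FB.
move=> [/(lnorm_lty u q0)[A uA] /(energy_norm_lty u p0)[B uB]].
have /choice[phi hphi] : forall k : nat, exists phi, finitely_supported phi /\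
    forall j, sums_le (fun x => `|L j (fun y => u y - phi y) x| `^ p) k.+1%:R^-1.
  move=> k; have k0 : 0 < k.+1%:R^-1 :> R by rewrite invr_gt0.
  by have [phi f1 f2] := dense u A B _ k0 uA uB; exists phi.
have small d : 0 < d -> \forall k \near \oo, k.+1%:R^-1 < d :> R.
  move=> d0; near=> k.
  suff : `|0 - k.+1%:R^-1 : R| < d by rewrite sub0r normrN ger0_norm// invr_ge0.
  by near: k; exact: (cvgrPdist_lt _ _).1 (@cvg_harmonic R) _ d0.
exists phi; split.
- by move=> k; have [] := hphi k.
- move=> e e0; have [d d0 hd] := energy_norm_small p0 e0.
  pose d' := d / (2 `^ p * 2).
  have p20 : 0 < 2 `^ p :> R by rewrite powR_gt0.
  have d'0 : 0 < d' by rewrite divr_gt0// mulr_gt0.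
  have [n0 _ hn0] := small _ d'0.
  exists n0 => k l n0k n0l; apply: hd => j.
  have [_ hk] := hphi k; have [_ hl] := hphi l.
  have hk' : sums_le (fun x => `|- L j (fun y => u y - phi k y) x| `^ p) k.+1%:R^-1.
    by apply: (sums_le_mono (hk j)) => // x; rewrite normrN.
  apply: (sums_le_mono (sums_le_powD (ltW p0) (hl j) hk')) => [x|].
    have -> : L j (fun y => u y - phi l y) x - L j (fun y => u y - phi k y) x =
      L j (fun y => phi k y - phi l y) x by rewrite !LB; ring.
    exact: lexx.
  apply: (@le_trans _ _ (2 `^ p * (d' + d'))).
    by rewrite ler_wpM2l ?(ltW p20)// lerD// ltW//; apply: hn0.
  by rewrite le_eqVlt; apply/orP; left; apply/eqP; rewrite /d'; field; rewrite gt_eqF.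
- move=> x; apply/cvgrPdist_lt => e e0.
  pose c := C `^ q^-1; have c0 : 0 <= c by exact: powR_ge0.
  pose d := (e / (c + 1)) `^ p.
  have ec : 0 < e / (c + 1) by rewrite divr_gt0//; lra.
  have d0 : 0 < d by rewrite powR_gt0.
  near=> k; have kd : k.+1%:R^-1 < d by near: k; exact: small.
  have [fk hk] := hphi k.
  have uv : vanishing u by exact: vanishing_sums q0 uA.
  have := sobolev _ _ (vanishingB uv (vanishing_finsupp fk)) hk.
  move=> /(sums_le_point x) hx.
  rewrite -[ltLHS](@powRK _ _ q) ?gt_eqF//.
  have q10 : 0 <= q^-1 by rewrite invr_ge0 ltW.
  apply: le_lt_trans (powR_le q10 (powR_ge0 _ _) hx) _.
  rewrite powRM ?powR_ge0// -powRrM mulrAC divff ?gt_eqF// mul1r.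
  apply: (@le_lt_trans _ _ (c * (e / (c + 1)))).
    rewrite ler_wpM2l// -[leRHS](@powRK _ _ p) ?gt_eqF ?(ltW ec)//.
    by apply: powR_le; rewrite ?invr_ge0 ?(ltW p0)// ltW.
  by rewrite mulrA ltr_pdivrMr; lra.
Unshelve. all: by end_near. Qed.

End EnergyNorm.

(** * Cutoff functions *)

Section SquaredPositivePart.
Context {R : realType}.
Implicit Types a b s t r : R.

Definition sqr_pos t : R := Num.max t 0 ^+ 2.

Lemma sqr_pos_taylor s t :
  `|sqr_pos t - sqr_pos s - 2 * Num.max s 0 * (t - s)| <= (t - s) ^+ 2.
Proof.
have t2 := sqr_ge0 t; have s2 := sqr_ge0 s; have ts2 := sqr_ge0 (t - s).
have E : (t - s) ^+ 2 = t ^+ 2 - 2 * (t * s) + s ^+ 2 by ring.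
rewrite ler_norml /sqr_pos; case: (leP t 0) => t0; case: (leP s 0) => s0;
  rewrite ?expr0n/= E.
- by apply/andP; split; lra.
- by have := mulr_le0_ge0 t0 (ltW s0) => ?; apply/andP; split; lra.
- by have := mulr_ge0_le0 (ltW t0) s0 => ?; apply/andP; split; lra.
- by have := mulr_gt0 t0 s0 => ?; apply/andP; split; lra.
Qed.

(** The constant is [2 * 7 + 7^2]: the derivative at [s <= 1] is at most [2]. *)
Lemma sqr_pos_diff1 s t r : 1 <= r -> s <= 1 -> `|t - s| <= 7 / r ->
  `|sqr_pos t - sqr_pos s| <= 63 / r.
Proof.
move=> r1 s1; have r0 : 0 < r by lra.
have rV : 0 < r^-1 <= 1 by rewrite invr_gt0 r0 invf_le1.
move: (r^-1) rV => d /andP[d0 d1] ts.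
have m0 : 0 <= Num.max s 0 <= 1.
  by rewrite le_max lexx orbT ge_max s1 ler01.
have := sqr_pos_taylor s t; move: ts; rewrite !ler_norml.
set A := sqr_pos t; set B := sqr_pos s; move: (Num.max s 0) m0 => m /andP[m0 m1].
set e := t - s => /andP[e1 e2] /andP[h1 h2].
have : e ^+ 2 <= 49 * d by nra.
have : - (14 * d) <= 2 * m * e by nra.
have : 2 * m * e <= 14 * d by nra.
by move=> *; apply/andP; split; lra.
Qed.

(** The derivative at [a1 <= 1], at most [2], multiplies the second difference
    of the arguments; the Taylor remainders at [a4], [a3] and [a2] contribute
    [16^2 + 7^2 + 7^2]. *)
Lemma sqr_pos_diff2 a1 a2 a3 a4 r : 1 <= r -> a1 <= 1 ->
  `|a2 - a1| <= 7 / r -> `|a3 - a1| <= 7 / r ->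
  `|a4 - a3 - (a2 - a1)| <= 2 / r ^+ 2 ->
  `|sqr_pos a4 - sqr_pos a3 - (sqr_pos a2 - sqr_pos a1)| <= 358 / r ^+ 2.
Proof.
move=> r1 s1; have r0 : 0 < r by lra.
have rV : 0 < r^-1 <= 1 by rewrite invr_gt0 r0 invf_le1.
rewrite -exprVn; move: (r^-1) rV => d /andP[d0 d1].
have m0 : 0 <= Num.max a1 0 <= 1.
  by rewrite le_max lexx orbT ge_max s1 ler01.
have := sqr_pos_taylor a1 a2; have := sqr_pos_taylor a1 a3.
have := sqr_pos_taylor a1 a4; rewrite !ler_norml.
set A := sqr_pos a1; set B := sqr_pos a2; set C := sqr_pos a3; set D := sqr_pos a4.
move: (Num.max a1 0) m0 => m /andP[m0 m1].
set e2 := a2 - a1; set e3 := a3 - a1.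
have -> : a4 - a3 - e2 = (a4 - a1) - e3 - e2 by rewrite /e2 /e3; ring.
set e4 := a4 - a1.
move=> /andP[h1 h2] /andP[h3 h4] /andP[h5 h6] /andP[k1 k2] /andP[k3 k4] /andP[k5 k6].
have d2 : d ^+ 2 <= d by nra.
have d20 : 0 <= d ^+ 2 by nra.
have l1 : - (16 * d) <= e4 by lra.
have l2 : e4 <= 16 * d by lra.
have q2 : e2 ^+ 2 <= 49 * d ^+ 2 by nra.
have q3 : e3 ^+ 2 <= 49 * d ^+ 2 by nra.
have q4 : e4 ^+ 2 <= 256 * d ^+ 2 by nra.
have x1 : - (4 * d ^+ 2) <= 2 * m * (e4 - e3 - e2) by nra.
have x2 : 2 * m * (e4 - e3 - e2) <= 4 * d ^+ 2 by nra.
have E : 2 * m * (e4 - e3 - e2) = 2 * m * e4 - 2 * m * e3 - 2 * m * e2 by ring.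
rewrite E in x1 x2.
by apply/andP; split; lra.
Qed.

End SquaredPositivePart.

Section Cutoff.
Context {R : realType} {N : nat}.
Local Notation ZN := 'rV[int]_N.
Implicit Types (u f g : ZN -> R) (x : ZN) (r : R) (i j : 'I_N * bool).
Local Notation n := (N%:R : R).

Definition coord x (k : 'I_N) : R := (x 0 k)%:~R.

Definition sqr_norm x : R := \sum_k coord x k ^+ 2.

Definition gen_sign i : R := (-1) ^+ (~~ i.2).

Lemma coord_gen x i k :
  coord (x + gen i) k = coord x k + gen_sign i * (i.1 == k)%:R.
Proof.
rewrite /coord mxE genE /gen_sign intrD; congr (_ + _).
by case: i.2; case: (i.1 == k); rewrite /= ?mulr1 ?mulr0 ?expr1 ?expr0 ?rmorphN1.
Qed.

Lemma gen_sign_cases i : gen_sign i = 1 \/ gen_sign i = -1.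
Proof. by rewrite /gen_sign; case: i.2; [left|right]. Qed.

Lemma sqr_norm_gen x i :
  sqr_norm (x + gen i) = sqr_norm x + 2 * gen_sign i * coord x i.1 + 1.
Proof.
rewrite /sqr_norm (bigD1 i.1)//= [X in _ = X + _ + _](bigD1 i.1)//=.
rewrite coord_gen eqxx mulr1.
have -> : \sum_(k < N | k != i.1) coord (x + gen i) k ^+ 2 =
    \sum_(k < N | k != i.1) coord x k ^+ 2.
  apply: eq_bigr => k ki; rewrite coord_gen eq_sym (negPf ki) mulr0 addr0//.
by case: (gen_sign_cases i) => ->; ring.
Qed.

Definition bump r x : R := 1 - sqr_norm x / r ^+ 2.

(** A cutoff at scale [r]: its first and second differences are of order [1/r]
    and [1/r^2], the latter because the square of the positive part has a
    Lipschitz continuous derivative. *)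
Definition cutoff r x : R := sqr_pos (bump r x).

(** The factor [3] leaves room for two unit steps: if some coordinate of [x] is
    larger than [3 r], with [r >= 1], then the cutoff is zero at all points that
    enter its first and second differences at [x]. *)
Definition in_box r x := [forall k, `|coord x k| <= 3 * r].

Lemma bump_le1 r x : bump r x <= 1.
Proof.
rewrite /bump gerBl divr_ge0 ?sqr_ge0//.
by apply: sumr_ge0 => k _; exact: sqr_ge0.
Qed.

Lemma bump_le0 r x k : 0 < r -> r <= `|coord x k| -> bump r x <= 0.
Proof.
move=> r0 rx; rewrite /bump subr_le0 ler_pdivlMr ?exprn_gt0// mul1r.
rewrite /sqr_norm (bigD1 k)//= -[leLHS]addr0 lerD//.
  by rewrite -(real_normK (num_real (coord x k))) lerXn2r ?nnegrE// ltW.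
by apply: sumr_ge0 => j _; exact: sqr_ge0.
Qed.

Lemma cutoff_eq0 r x k : 0 < r -> r <= `|coord x k| -> cutoff r x = 0.
Proof.
move=> r0 /(bump_le0 r0) b0; rewrite /cutoff /sqr_pos.
by move: b0; case: leP => // _ _; rewrite expr0n.
Qed.

Lemma coord_gen_dist x i k : `|coord (x + gen i) k - coord x k| <= 1.
Proof.
rewrite coord_gen addrC addKr normrM.
have -> : `|gen_sign i| = 1 by rewrite /gen_sign normr_sign.
by rewrite mul1r normr_nat; case: (_ == _).
Qed.

Lemma coord_gen_ge x i k : `|coord x k| - 1 <= `|coord (x + gen i) k|.
Proof.
have := coord_gen_dist x i k; rewrite distrC => h.
by have := lerB_dist (coord x k) (coord (x + gen i) k); lra.
Qed.

Lemma notin_box r x : ~~ in_box r x -> exists k, 3 * r < `|coord x k|.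
Proof. by rewrite negb_forall => /existsP[k]; rewrite -ltNge => ?; exists k. Qed.

Lemma pderiv_bump r x i :
  pderiv i (bump r) x = - (2 * gen_sign i * coord x i.1 + 1) / r ^+ 2.
Proof. by rewrite /pderiv /bump sqr_norm_gen; ring. Qed.

Lemma pderiv_bump_le r x i : 1 <= r -> in_box r x ->
  `|pderiv i (bump r) x| <= 7 / r.
Proof.
move=> r1 /forallP/(_ i.1) hx; have r0 : 0 < r by lra.
rewrite pderiv_bump normrM normrN normfV (ger0_norm (sqr_ge0 r)).
have r20 : 0 < r ^+ 2 by rewrite exprn_gt0.
rewrite ler_pdivrMr//.
have -> : 7 / r * r ^+ 2 = 7 * r by field; rewrite gt_eqF.
move: hx; rewrite !ler_norml => /andP[h1 h2].
by case: (gen_sign_cases i) => ->; apply/andP; split; lra.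
Qed.

Lemma pderiv2_bump_le r x i j : 0 < r ->
  `|pderiv j (pderiv i (bump r)) x| <= 2 / r ^+ 2.
Proof.
move=> r0; have r20 : 0 < r ^+ 2 by rewrite exprn_gt0.
rewrite {1}/pderiv !pderiv_bump.
have -> : - (2 * gen_sign i * coord (x + gen j) i.1 + 1) / r ^+ 2 -
  - (2 * gen_sign i * coord x i.1 + 1) / r ^+ 2 =
  - (2 * gen_sign i) * (coord (x + gen j) i.1 - coord x i.1) / r ^+ 2 by ring.
rewrite normrM normfV (ger0_norm (sqr_ge0 r)) ler_pM2r ?invr_gt0//.
rewrite normrM normrN normrM.
have -> : `|gen_sign i| = 1 by rewrite /gen_sign normr_sign.
by have := coord_gen_dist x j i.1; rewrite ger0_norm//; lra.
Qed.

Lemma pderiv_cutoff_le r x i : 1 <= r ->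
  `|pderiv i (cutoff r) x| <= 63 / r * (in_box r x)%:R.
Proof.
move=> r1; have r0 : 0 < r by lra.
have [xb|/notin_box[k xk]] := boolP (in_box r x).
  rewrite mulr1; apply: sqr_pos_diff1 => //; first exact: bump_le1.
  exact: pderiv_bump_le.
rewrite mulr0 /pderiv !(@cutoff_eq0 _ _ k)//; try lra.
  by rewrite subrr normr0.
by have := coord_gen_ge x i k; lra.
Qed.

Lemma pderiv2_cutoff_le r x i j : 1 <= r ->
  `|pderiv j (pderiv i (cutoff r)) x| <= 358 / r ^+ 2 * (in_box r x)%:R.
Proof.
move=> r1; have r0 : 0 < r by lra.
have [xb|/notin_box[k xk]] := boolP (in_box r x).
  rewrite mulr1; apply: sqr_pos_diff2 => //; first exact: bump_le1.
  - exact: pderiv_bump_le.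
  - exact: pderiv_bump_le.
  - exact: pderiv2_bump_le.
have h1 := coord_gen_ge x i k; have h2 := coord_gen_ge x j k.
have h3 := coord_gen_ge (x + gen j) i k.
rewrite mulr0 /pderiv !(@cutoff_eq0 _ _ k)//; try lra.
by rewrite !subrr normr0.
Qed.

Lemma cutoff_dist r x : 1 <= r -> `|1 - cutoff r x| <= 2 * sqr_norm x / r.
Proof.
move=> r1; have r0 : 0 < r by lra.
have s0 : 0 <= sqr_norm x by apply: sumr_ge0 => k _; exact: sqr_ge0.
apply: (@le_trans _ _ (2 * (1 - bump r x))).
  have := bump_le1 r x; rewrite /cutoff /sqr_pos ler_norml.
  by case: (leP (bump r x) 0) => ? ?; apply/andP; split; nra.
rewrite /bump subKr -mulrA ler_wpM2l// ler_wpM2l//.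
by rewrite lef_pV2 ?posrE ?exprn_gt0//; nra.
Qed.

Lemma cutoff_dist1 r x : `|1 - cutoff r x| <= 1.
Proof.
have := bump_le1 r x; rewrite /cutoff /sqr_pos ler_norml.
by case: (leP (bump r x) 0) => ? ?; apply/andP; split; nra.
Qed.

(** The points of the box are those of [box_pt] with side [6 m + 1], translated
    by [- 3 m] in each coordinate. *)
Lemma in_box_sums (m : nat) : (0 < m)%N ->
  sums_le (fun x => (in_box m%:R x)%:R : R) ((7 * m%:R) ^+ N).
Proof.
move=> m0 t ut; pose L := (6 * m).+1.
rewrite -natr_sum -big_mkcond sum1_count -size_filter.
apply: (@le_trans _ _ (L ^ N)%:R); last first.
  rewrite natrX lerXn2r ?nnegrE// ?mulr_ge0// -natrM ler_nat /L; lia.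
rewrite ler_nat.
pose c : ZN := \row_k (3 * m)%:Z.
have -> : (L ^ N = size [seq (box_pt b - c)%R | b <- enum {ffun 'I_N -> 'I_L}])%N.
  by rewrite size_map -cardE card_ffun !card_ord.
apply: uniq_leq_size => [|x]; first by rewrite filter_uniq.
rewrite mem_filter => /andP[/forallP xb _]; apply/mapP.
have hk k : (-(3 * m)%:Z <= x 0 k <= (3 * m)%:Z).
  have := xb k; rewrite ler_norml /coord => /andP[h1 h2].
  by rewrite -!(ler_int R) intrN -!pmulrn natrM; apply/andP; split; lra.
exists [ffun k => inord (absz (x 0 k + (3 * m)%:Z)) : 'I_L].
  by rewrite mem_enum.
apply/rowP => k; rewrite !mxE box_ptE ffunE inordK; first by have := hk k; lia.
by have := hk k; rewrite /L; lia.
Qed.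

Lemma finsupp_cutoff (m : nat) : (0 < m)%N -> finitely_supported (cutoff m%:R).
Proof.
move=> m0; have m0' : 0 < m%:R :> R by rewrite ltr0n.
have : vanishing (fun x => (in_box m%:R x)%:R : R).
  apply: (@vanishing_sums _ _ _ 1); first exact: ltr01.
  by apply: (sums_le_mono (in_box_sums m0)) => // x; rewrite powRr1// normr_nat.
move=> /(_ 1 ltr01); apply: sub_finite_set => x /=; apply: contraNT.
rewrite normr_nat -ltNge => h.
have /notin_box[k xk] : ~~ in_box m%:R x by move: h; case: in_box => //; rewrite ltxx.
by apply/eqP; apply: (@cutoff_eq0 _ _ k) => //; lra.
Qed.

(** The number of points of the box, of order [m^N], cancels the decay of
    [(1 / m^k)^(N/k)]. *)
Lemma in_box_multiplier (c : R) (k m : nat) f : (0 < k)%N -> (0 < m)%N -> (0 < N)%N ->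
  0 <= c -> (forall x, `|f x| <= c / m%:R ^+ k * (in_box m%:R x)%:R) ->
  sums_le (fun x => `|f x| `^ (n / k%:R)) (c `^ (n / k%:R) * 7 ^+ N).
Proof.
move=> k0 m0 N0 c0 hf; have m0' : 0 < m%:R :> R by rewrite ltr0n.
have nk : 0 < n / k%:R by rewrite divr_gt0// ltr0n.
have h := sums_leZ (powR_ge0 (c / m%:R ^+ k) (n / k%:R)) (in_box_sums m0).
apply: (sums_le_mono h) => [x|].
  apply: le_trans (powR_le (ltW nk) _ (hf x)) _ => //.
  rewrite powRM ?divr_ge0// ?exprn_ge0//.
  rewrite ler_wpM2l ?powR_ge0//.
  by case: in_box => /=; rewrite ?powR1// powR0 ?lexx// gt_eqF.
rewrite powRM ?invr_ge0 ?exprn_ge0 ?(ltW m0')// -mulrA ler_wpM2l ?powR_ge0//.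
have -> : (m%:R ^+ k)^-1 `^ (n / k%:R) = (m%:R ^+ N)^-1 :> R.
  rewrite -powR_inv1 ?exprn_ge0 ?(ltW m0')// powRAC -powR_mulrn ?(ltW m0')//.
  rewrite -(powRrM _ k%:R) mulrCA divff ?mulr1 ?pnatr_eq0 -?lt0n// powR_mulrn ?(ltW m0')//.
  by rewrite powR_inv1// exprn_ge0// ltW.
by rewrite exprMn mulrCA mulVf ?mulr1// gt_eqF// exprn_gt0.
Qed.

End Cutoff.

(** * Approximation by cutoffs *)

Section CutoffApproximation.
Context {R : realType} {N : nat}.
Local Notation ZN := 'rV[int]_N.
Implicit Types (u f g : ZN -> R) (x : ZN) (A B K a p q : R) (i j : 'I_N * bool).
Local Notation n := (N%:R : R).

(** A function in l^a is split into a finite part, on which pointwise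
    convergence of the multipliers suffices, and a small tail, on which their
    uniform boundedness from l^a to l^p is used. *)
Lemma multiplier_vanish (W : nat -> ZN -> R) a p K A g (e : R) :
  1 <= p -> 1 <= a -> 0 <= K -> 0 < e ->
  (forall m f B, sums_le (fun x => `|f x| `^ a) B ->
    sums_le (fun x => `|W m x * f x| `^ p) (K * B `^ (p / a))) ->
  (forall x, W m x @[m --> \oo] --> 0) ->
  sums_le (fun x => `|g x| `^ a) A ->
  \forall m \near \oo, sums_le (fun x => `|W m x * g x| `^ p) e.
Proof.
move=> p1 a1 K0 e0 WK W0 gA.
have p0 : 0 < p by lra.
have a0 : 0 < a by lra.
have p20 : 0 < 2 `^ p :> R by rewrite powR_gt0.
pose e' := e / (2 `^ p * 2).
have e'0 : 0 < e' by rewrite divr_gt0// mulr_gt0.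
pose d := (e' / (K + 1)) `^ (a / p).
have eK : 0 < e' / (K + 1) by rewrite divr_gt0//; lra.
have d0 : 0 < d by rewrite powR_gt0.
have [s us hs] := sums_tail (fun x => powR_ge0 `|g x| a) gA d0.
pose g1 x := if x \in s then g x else 0.
pose g2 x := if x \in s then 0 else g x.
have hg2 : sums_le (fun x => `|g2 x| `^ a) d.
  apply: (sums_le_mono hs) => // x; rewrite /g2; case: ifP => // _.
  by rewrite normr0 powR0// gt_eqF.
have Wg2 m : sums_le (fun x => `|W m x * g2 x| `^ p) e'.
  apply: (sums_le_mono (WK m _ _ hg2)) => //.
  have -> : d `^ (p / a) = e' / (K + 1).
    rewrite /d -powRrM.
    have -> : a / p * (p / a) = 1 by field; rewrite !gt_eqF.
    by rewrite powRr1// ltW.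
  by rewrite mulrA ler_pdivrMr; nra.
pose S m := \sum_(x <- s) `|W m x * g x| `^ p.
have Wg1 m : sums_le (fun x => `|W m x * g1 x| `^ p) (S m).
  have fs1 : finitely_supported (fun x => `|W m x * g1 x| `^ p).
    apply/finsuppP; exists s => // x xs.
    by rewrite /g1 (negPf xs) mulr0 normr0 powR0// gt_eqF.
  apply: (sums_le_mono (sums_le_fsum fs1 _)) => //.
  rewrite (fsumE us) => [|x xs]; last first.
    by rewrite /g1 (negPf xs) mulr0 normr0 powR0// gt_eqF.
  by rewrite /S le_eqVlt; apply/orP; left; apply/eqP; apply: eq_big_seq => x xs;
    rewrite /g1 xs.
have S0 : S m @[m --> \oo] --> 0.
  have <- : \sum_(x <- s) `|0 : R| `^ p = 0.
    by rewrite big1// => x _; rewrite normr0 powR0// gt_eqF.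
  apply: (@cvg_sum_seq _ _ s (fun m x => `|W m x * g x| `^ p)) => x.
  apply: cvg_normpow => //; rewrite -(mul0r (g x)).
  by apply: cvgMl; exact: W0.
near=> m.
have Se : S m <= e'.
  suff : `|0 - S m| < e'.
    by rewrite sub0r normrN => /ltW; apply: le_trans; exact: ler_norm.
  by near: m; exact: (cvgrPdist_lt _ _).1 S0 _ e'0.
apply: (sums_le_mono (sums_le_powD (ltW p0) (Wg1 m) (Wg2 m))) => [x|].
  rewrite -mulrDr /g1 /g2; case: ifP => _; first by rewrite addr0.
  by rewrite add0r.
apply: (@le_trans _ _ (2 `^ p * (e' + e'))); first by rewrite ler_wpM2l ?(ltW p20)// lerD2r.
by rewrite le_eqVlt; apply/orP; left; apply/eqP; rewrite /e'; field; rewrite gt_eqF.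
Unshelve. all: by end_near. Qed.

(** Hoelder's inequality with [1/p = 1/a + k/n]. *)
Lemma multiplier_bound (k : nat) (w : ZN -> R) p a G A f :
  (0 < k)%N -> 0 < p -> k%:R * p < n -> a = n * p / (n - k%:R * p) ->
  sums_le (fun x => `|w x| `^ (n / k%:R)) G ->
  sums_le (fun x => `|f x| `^ a) A ->
  sums_le (fun x => `|w x * f x| `^ p) (G `^ (k%:R * p / n) * A `^ (p / a)).
Proof.
move=> k0 p0 kp aE wG fA; have k0' : 0 < k%:R :> R by rewrite ltr0n.
have n0 : 0 < n by apply: le_lt_trans kp; rewrite mulr_ge0// ltW.
have nkp : 0 < n - k%:R * p by lra.
have a0 : 0 < a by rewrite aE divr_gt0// mulr_gt0.
have := @sums_hoelder R N (fun x => `|w x| `^ p) (fun x => `|f x| `^ p)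
  (n / (k%:R * p)) (a / p) G A.
rewrite !invf_div => h.
have {}h := h (divr_gt0 n0 (mulr_gt0 k0' p0)) (divr_gt0 a0 p0).
have {}h : sums_le (fun x => `|w x| `^ p * `|f x| `^ p)
    (G `^ (k%:R * p / n) * A `^ (p / a)).
  apply: h.
  - by rewrite aE; field; rewrite !gt_eqF.
  - by move=> x; exact: powR_ge0.
  - by move=> x; exact: powR_ge0.
  - apply: (sums_le_mono wG) => // x; rewrite -powRrM.
    have -> : p * (n / (k%:R * p)) = n / k%:R by field; rewrite !gt_eqF.
    exact: lexx.
  - apply: (sums_le_mono fA) => // x; rewrite -powRrM.
    have -> : p * (a / p) = a by field; rewrite gt_eqF.
    exact: lexx.
by apply: (sums_le_mono h) => // x; rewrite normrM powRM.
Qed.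

Lemma cvg0_harmonic_bound (F : nat -> R) (c : R) :
  (forall m, `|F m| <= c / m.+1%:R) -> F m @[m --> \oo] --> 0.
Proof.
move=> Fc; have c0 : 0 <= c.
  by have := Fc 0%N; rewrite divr1; apply: le_trans.
have c1 : 0 < c + 1 by lra.
apply/cvgrPdist_lt => e e0; have ec0 : 0 < e / (c + 1) by rewrite divr_gt0.
near=> m; rewrite sub0r normrN; apply: le_lt_trans (Fc m) _.
have h : m.+1%:R^-1 < e / (c + 1).
  suff : `|0 - m.+1%:R^-1 : R| < e / (c + 1).
    by rewrite sub0r normrN ger0_norm// invr_ge0.
  by near: m; exact: (cvgrPdist_lt _ _).1 (@cvg_harmonic R) _ ec0.
apply: (@le_lt_trans _ _ (c * (e / (c + 1)))); first by rewrite ler_wpM2l// ltW.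
by rewrite mulrA ltr_pdivrMr//; nra.
Unshelve. all: by end_near. Qed.

(** The Leibniz rule; the translations that it produces do not change norms. *)
Lemma pderiv2_cutoff_mul (eta u : ZN -> R) i j x :
  pderiv j (pderiv i (fun y => u y - eta y * u y)) x =
  (1 - eta x) * pderiv j (pderiv i u) x +
  (- pderiv j eta x * pderiv i u (x + gen j) +
   (- pderiv i eta x * pderiv j u (x + gen i) +
    - pderiv j (pderiv i eta) x * u (x + gen j + gen i))).
Proof. by rewrite /pderiv [x + gen i + gen j]addrAC; ring. Qed.

(** Each of the four terms of the Leibniz rule is a multiplier applied to a
    fixed function.  Those coming from first and second differences of the
    cutoff are uniformly bounded since [1/p = 1/p' + 1/n = 1/p'' + 2/n] for the
    exponents [p'] and [p''] at hand. *)
Theorem cutoff_approximation p u A A1 B (e : R) : (2 < N)%N ->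
  1 <= p -> p < n / 2 -> 0 < e ->
  sums_le (fun x => `|u x| `^ @sobolev_exp R N p) A ->
  (forall i, sums_le (fun x => `|pderiv i u x| `^ @sobolev1_exp R N p) A1) ->
  (forall i j, sums_le (fun x => `|pderiv j (pderiv i u) x| `^ p) B) ->
  exists2 phi, finitely_supported phi & forall i j,
    sums_le (fun x => `|pderiv j (pderiv i (fun y => u y - phi y)) x| `^ p) e.
Proof.
move=> N2 p1 pn e0 uA uA1 uB; have N0 : (0 < N)%N by apply: leq_trans N2.
have n2 : 2 < n by rewrite ltr_nat.
have p0 : 0 < p by lra.
pose eta (m : nat) : ZN -> R := cutoff m.+1%:R.
have m1 (m : nat) : 1 <= m.+1%:R :> R by rewrite ler1n.
have p20 : 0 < 2 `^ p :> R by rewrite powR_gt0.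
pose t : R := 2 `^ p.
pose d : R := e / (t * 2 * (t * 2 * (t * 2))).
have d0 : 0 < d by rewrite divr_gt0// !mulr_gt0.
pose G1 : R := 63 `^ (n / 1%:R) * 7 ^+ N.
pose G2 : R := 358 `^ (n / 2%:R) * 7 ^+ N.
have q1 : 1 <= @sobolev_exp R N p by rewrite /sobolev_exp ler_pdivlMr; nra.
have r1 : 1 <= @sobolev1_exp R N p by rewrite /sobolev1_exp ler_pdivlMr; nra.
have T0 i j : \forall m \near \oo, sums_le
    (fun x => `|(1 - eta m x) * pderiv j (pderiv i u) x| `^ p) d.
  apply: (multiplier_vanish p1 p1 ler01 d0 _ _ (uB i j)).
    move=> m f b fb; rewrite mul1r divff ?gt_eqF// powRr1 ?(sums_le_ge0 fb)//.
    apply: (sums_le_mono fb) => // x; apply: powR_le => //; first exact: ltW.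
    by rewrite normrM ler_piMl// cutoff_dist1.
  move=> x; apply: (@cvg0_harmonic_bound _ (2 * sqr_norm x)) => m.
  exact: cutoff_dist.
have E1 : @sobolev1_exp R N p = n * p / (n - 1%:R * p) by rewrite mul1r.
have k1 : 1%:R * p < n by rewrite mul1r; lra.
have k2 : 2%:R * p < n by lra.
have W1 i (m : nat) : sums_le (fun x => `|- pderiv i (eta m) x| `^ (n / 1%:R)) G1.
  apply: (@in_box_multiplier _ _ 63 1 m.+1) => // x.
  by rewrite normrN expr1; exact: pderiv_cutoff_le.
have W2 i j (m : nat) :
    sums_le (fun x => `|- pderiv j (pderiv i (eta m)) x| `^ (n / 2%:R)) G2.
  apply: (@in_box_multiplier _ _ 358 2 m.+1) => // x.
  by rewrite normrN; exact: pderiv2_cutoff_le.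
have T1 i (g : ZN -> R) : sums_le (fun x => `|g x| `^ @sobolev1_exp R N p) A1 ->
    \forall m \near \oo, sums_le (fun x => `|- pderiv i (eta m) x * g x| `^ p) d.
  move=> gA; apply: (multiplier_vanish p1 r1 (powR_ge0 G1 (1%:R * p / n)) d0 _ _ gA).
    by move=> m f b fb; exact: (multiplier_bound (ltn0Sn 0) p0 k1 E1 (W1 i m) fb).
  move=> x; apply: (@cvg0_harmonic_bound _ 63) => m; rewrite normrN.
  apply: le_trans (pderiv_cutoff_le _ _ (m1 m)) _.
  by rewrite ler_piMr ?divr_ge0//; case: in_box.
have T2 i j (g : ZN -> R) : sums_le (fun x => `|g x| `^ @sobolev_exp R N p) A ->
    \forall m \near \oo, sums_le
      (fun x => `|- pderiv j (pderiv i (eta m)) x * g x| `^ p) d.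
  move=> gA; apply: (multiplier_vanish p1 q1 (powR_ge0 G2 (2%:R * p / n)) d0 _ _ gA).
    move=> m f b fb.
    exact: (multiplier_bound (ltn0Sn 1) p0 k2 erefl (W2 i j m) fb).
  move=> x; apply: (@cvg0_harmonic_bound _ 358) => m; rewrite normrN.
  apply: le_trans (pderiv2_cutoff_le _ _ _ (m1 m)) _.
  apply: (@le_trans _ _ (358 / m.+1%:R ^+ 2)).
    by rewrite ler_piMr ?divr_ge0 ?exprn_ge0//; case: in_box.
  rewrite ler_wpM2l// lef_pV2 ?posrE ?exprn_gt0 ?ltr0n//.
  by rewrite ler_eXnr.
have all_small : \forall m \near \oo, forall ij : ('I_N * bool) * ('I_N * bool),
    sums_le (fun x => `|pderiv ij.2 (pderiv ij.1
      (fun y => u y - eta m y * u y)) x| `^ p) e.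
  apply: filter_forall => -[i j] /=; near=> m.
  have h0 : sums_le (fun x => `|(1 - eta m x) * pderiv j (pderiv i u) x| `^ p) d.
    by near: m; exact: T0.
  have h1 : sums_le (fun x => `|- pderiv j (eta m) x * pderiv i u (x + gen j)| `^ p) d.
    by near: m; apply: T1; exact: (sums_le_shift (gen j) (uA1 i)).
  have h2 : sums_le (fun x => `|- pderiv i (eta m) x * pderiv j u (x + gen i)| `^ p) d.
    by near: m; apply: T1; exact: (sums_le_shift (gen i) (uA1 j)).
  have h3 : sums_le (fun x => `|- pderiv j (pderiv i (eta m)) x *
      u (x + gen j + gen i)| `^ p) d.
    near: m; apply: (T2 i j (fun x => u (x + gen j + gen i))).
    exact: (sums_le_shift (gen j) (sums_le_shift (gen i) uA)).
  have h := sums_le_powD (ltW p0) h0 (sums_le_powD (ltW p0) h1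
    (sums_le_powD (ltW p0) h2 h3)).
  apply: (sums_le_mono h) => [x|]; first by rewrite pderiv2_cutoff_mul.
  have t1 : 1 <= t.
    have h12 : 1 <= 2 :> R by lra.
    by have := ler_powR h12 (ltW p0); rewrite powRr0.
  have dE : e = t * 2 * (t * 2 * (t * 2)) * d.
    by rewrite /d; field; rewrite gt_eqF.
  rewrite -/t dE; have t2 : t <= t * t by rewrite ler_peMl//; lra.
  have t3 : t * t <= t * (t * t) by rewrite ler_peMl// mulr_ge0; lra.
  have -> : t * (d + t * (d + t * (d + d))) =
    (t + t * t + 2 * (t * (t * t))) * d by ring.
  by apply: ler_wpM2r; [exact: ltW|lra].
have [m _ /(_ m (leqnn m)) hm] := all_small.
exists (fun y => eta m y * u y).
  by apply: (finsupp_sub (finsupp_cutoff (ltn0Sn m))) => x; rewrite /eta => ->; rewrite mul0r.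
by move=> i j; exact: hm (i, j).
Unshelve. all: by end_near. Qed.

Lemma sobolev1_exp_twice p : (2 < N)%N -> 1 <= p -> p < n / 2 ->
  @sobolev1_exp R N (@sobolev1_exp R N p) = @sobolev_exp R N p.
Proof.
move=> N2 p1 pn; have n2 : 2 < n by rewrite ltr_nat.
have h : 0 < n * (n - p) - n * p.
  have -> : n * (n - p) - n * p = n * (n - 2 * p) by ring.
  by rewrite mulr_gt0//; lra.
rewrite /sobolev1_exp /sobolev_exp; field.
by rewrite !gt_eqF//; lra.
Qed.

(** The first order inequality is applied to the first differences of [u], then
    to [u]; both exponents remain below [n] because [p < n / 2]. *)
Theorem sobolev2 p : (2 < N)%N -> 1 <= p -> p < n / 2 ->
  exists2 C : R, 0 <= C & forall u B, vanishing u ->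
    (forall i j, sums_le (fun x => `|pderiv j (pderiv i u) x| `^ p) B) ->
    sums_le (fun x => `|u x| `^ @sobolev_exp R N p)
      (C * B `^ (@sobolev_exp R N p / p)).
Proof.
move=> N2 p1 pn; have n2 : 2 < n by rewrite ltr_nat.
have N1 : (1 < N)%N by apply: ltn_trans N2.
set r := @sobolev1_exp R N p; set q := @sobolev_exp R N p.
have r1 : 1 <= r by rewrite /r /sobolev1_exp ler_pdivlMr; nra.
have rn : r < n by rewrite /r /sobolev1_exp ltr_pdivrMr; nra.
have pn' : p < n by lra.
have [C1 C10 hC1] := sobolev1 N1 p1 pn'.
have [C2 C20 hC2] := sobolev1 N1 r1 rn.
exists (C2 * C1 `^ (q / r)); first by rewrite mulr_ge0// powR_ge0.
move=> u B uv hB.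
have h i : sums_le (fun x => `|pderiv i u x| `^ r) (C1 * B `^ (r / p)).
  by apply: hC1 (hB i); exact: vanishingB (vanishing_shift (gen i) uv) uv.
have := hC2 u _ uv h; rewrite sobolev1_exp_twice// -/q.
rewrite powRM ?powR_ge0// -powRrM.
have -> : r / p * (q / r) = q / p.
  by field; rewrite !gt_eqF//; lra.
by rewrite mulrA.
Qed.

End CutoffApproximation.

(** * The two density theorems *)

Section Completions.
Context {R : realType} {N : nat}.
Local Notation ZN := 'rV[int]_N.
Local Notation n := (N%:R : R).

Lemma D2norm_energy (p : R) :
  @D2norm R N p = energy_norm (fun _ : 'I_1 => laplacian) p.
Proof. by apply/funext => u; rewrite /energy_norm big_ord1. Qed.

Lemma D2tnorm_energy (p : R) : @D2tnorm R N p =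
  energy_norm (fun ij : ('I_N * bool) * ('I_N * bool) =>
    fun u => pderiv ij.2 (pderiv ij.1 u)) p.
Proof. by apply/funext => u; rewrite /energy_norm /D2tnorm pair_bigA. Qed.

Lemma cvg_pderiv i (F : nat -> ZN -> R) u x :
  (forall y, F k y @[k --> \oo] --> u y) ->
  pderiv i (F k) x @[k --> \oo] --> pderiv i u x.
Proof. by move=> Fu; apply: cvgB; exact: Fu. Qed.

Lemma D2_0E (p : R) : (2 < N)%N -> 1 < p -> p < n / 2 ->
  D2_0 p = D2 p :> set (ZN -> R).
Proof.
move=> N2 p1 pn; have n2 : 2 < n by rewrite ltr_nat.
have [C C0 hC] := sobolev_laplacian N2 p1 pn.
rewrite /D2_0 /D2 D2norm_energy; apply: completion_energy_norm C0 _ _ _ _ _.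
- exact: ltW.
- by rewrite /sobolev_exp ler_pdivlMr; nra.
- by move=> _ u v x; rewrite laplacianB.
- move=> _ F u x Fu; rewrite laplacianE; under eq_fun do rewrite laplacianE.
  apply: (@cvg_sum_seq _ _ _ (fun k i => pderiv i (F k) x)) => i.
  exact: cvg_pderiv.
- by move=> _ phi; exact: finsupp_laplacian.
- by move=> u B uv /(_ ord0); exact: hC.
- move=> u A B e e0 _ /(_ ord0) uB.
  by have [phi fphi hphi] := laplacian_dense N2 p1 pn e0 uB; exists phi.
Qed.

Lemma D2t_0E (p : R) : (2 < N)%N -> 1 <= p -> p < n / 2 ->
  D2t_0 p = D2t p :> set (ZN -> R).
Proof.
move=> N2 p1 pn; have n2 : 2 < n by rewrite ltr_nat.
have N1 : (1 < N)%N by apply: ltn_trans N2.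
have [C C0 hC] := sobolev2 N2 p1 pn.
have q1 : 1 <= @sobolev_exp R N p by rewrite /sobolev_exp ler_pdivlMr; nra.
rewrite /D2t_0 /D2t D2tnorm_energy; apply: completion_energy_norm C0 _ _ _ _ _ => //.
- by move=> [i j] u v x /=; rewrite /pderiv; ring.
- by move=> [i j] F u x Fu; do 2 apply: cvg_pderiv => ?; exact: Fu.
- by move=> [i j] phi fphi; do 2 apply: finsupp_pderiv.
- by move=> u B uv uB; apply: hC => // i j; exact: uB (i, j).
- move=> u A B e e0 uA uB.
  have uv : vanishing u.
    by apply: vanishing_sums uA; lra.
  have pn' : p < n by lra.
  have [C1 C10 hC1] := sobolev1 N1 p1 pn'.
  have uA1 i : sums_le (fun x => `|pderiv i u x| `^ @sobolev1_exp R N p)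
      (C1 * B `^ (@sobolev1_exp R N p / p)).
    apply: hC1 => [|j]; first exact: vanishingB (vanishing_shift (gen i) uv) uv.
    exact: uB (i, j).
  have [phi fphi hphi] := cutoff_approximation N2 p1 pn e0 uA uA1
    (fun i j => uB (i, j)).
  by exists phi => // -[i j]; exact: hphi.
Qed.

End Completions.

Theorem theorem11 (R : realType) (N : nat) (N3 : (3 <= N)%N) :
  (forall p : R, 1 < p -> p < N%:R / 2 -> D2_0 p = D2 p :> set ('rV[int]_N -> R)) /\
  (forall p : R, 1 <= p -> p < N%:R / 2 -> D2t_0 p = D2t p :> set ('rV[int]_N -> R)).
Proof. by split=> p p1 pN; [exact: D2_0E|exact: D2t_0E]. Qed.
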